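(* Fix $k \in \mathbb{N}_0$. For all clause-sets $F, F' \in \mathrm{WC}_k$ (note $\mathrm{WC}_k \supseteq \mathrm{UC}_k \supseteq \mathrm{PC}_k$), the queries CO, CE, VA, IM, EQ and SE are decidable in polynomial time (in $\ell(F)$). Furthermore, ME is possible in time $p(\ell(F), m)$ for some fixed polynomial $p$, where $m$ is the number of satisfying total assignments of $F$.
   Context: Clauses are finite sets of literals without complementary pair; clause-sets (interpreted as CNFs) are finite sets of clauses; $\ell(F)=\sum_{C\in F}|C|$. A partial assignment $\varphi$ applied to $F$, $\varphi*F$, removes clauses containing a literal set to $1$ and removes literals set to $0$. W-hardness $\mathrm{whd}(F)$: for unsatisfiable $F$ the minimum $k$ such that a resolution tree deriving the empty clause from $F$ exists in which each resolution step has a parent clause of length at most $k$; $\mathrm{whd}$ of the empty clause-set is $0$; for satisfiable nonempty $F$ the maximum of $\mathrm{whd}(\varphi*F)$ over partial assignments with $\varphi*F$ unsatisfiable. $\mathrm{WC}_k := \{F : \mathrm{whd}(F)\le k\}$. Queries for a clause-set $F$ representing the boolean function on $\mathrm{var}(F)$: CO — whether $F$ is satisfiable; CE — given a clause $C$, whether $F\models C$; VA — whether $F$ is satisfied by all total assignments; IM — given a partial assignment $\varphi$, whether every total extension of $\varphi$ satisfies $F$; SE — given $F,F'$, whether $F\models F'$; EQ — given $F,F'$, whether they are logically equivalent; ME — enumerate all satisfying total assignments of $F$. *)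

(* Defs.v *)
From HB Require Import structures.
From Stdlib Require List.
From mathcomp Require Import all_boot all_order all_algebra finmap.

Set Implicit Arguments.
Unset Strict Implicit.
Unset Printing Implicit Defensive.

Local Open Scope fset_scope.
Local Open Scope fmap_scope.

(** * Clause-sets *)

Definition var := nat.

(* [(v, b)] is the literal that is true iff [v] has value [b]. *)
Definition lit : Type := var * bool.

Definition neg (x : lit) : lit := (x.1, ~~ x.2).

Definition clash_free (C : {fset lit}) : bool := all (fun x => neg x \notin C) C.

Record clause := Clause { lits :> {fset lit}; _ : clash_free lits }.
HB.instance Definition _ := [isSub for lits].
HB.instance Definition _ := [Choice of clause by <:].

Definition clause_set := {fset clause}.

Fact bot_subproof : clash_free fset0.
Proof. by apply/allP. Qed.

Definition bot : clause := Clause bot_subproof.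

Definition vars_clause (C : clause) : {fset var} := [fset x.1 | x in lits C].
Definition vars (F : clause_set) : {fset var} := \bigcup_(C <- F) vars_clause C.

Definition ell (F : clause_set) : nat := (\sum_(C <- F) #|` lits C|)%N.

(** * Partial assignments *)

Definition passign := {fmap var -> bool}.

Definition lit_true (phi : passign) (x : lit) : bool := phi.[? x.1] == Some x.2.
Definition lit_false (phi : passign) (x : lit) : bool :=
  phi.[? x.1] == Some (~~ x.2).

Fact reduct_subproof (phi : passign) (C : clause) :
  clash_free [fset x in lits C | ~~ lit_false phi x].
Proof.
have /allP cfC := valP C; apply/allP => x; rewrite !inE /= => /andP[xC _].
by rewrite negb_and cfC.
Qed.

Definition reduct (phi : passign) (C : clause) : clause :=
  Clause (reduct_subproof phi C).

(* [phi * F] *)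
Definition apply (phi : passign) (F : clause_set) : clause_set :=
  [fset reduct phi C | C in F & ~~ has (lit_true phi) (lits C)].

Definition satisfies (phi : passign) (F : clause_set) : bool :=
  apply phi F == fset0.

Definition satisfiable (F : clause_set) : Prop := exists phi, satisfies phi F.

Definition total_on (V : {fset var}) (phi : passign) : bool := V `<=` domf phi.

Definition extends (phi psi : passign) : Prop :=
  forall v b, phi.[? v] = Some b -> psi.[? v] = Some b.

(** * W-hardness *)

(* [wres k F C]: there is a resolution tree deriving [C] from [F] in which every
   step has a parent of length at most [k].  Since the conclusion [R] is a
   clause, the parents of a step clash in exactly one literal. *)
Inductive wres (k : nat) (F : clause_set) : clause -> Prop :=
| wres_axiom (C : clause) : C \in F -> wres k F C
| wres_step (x : lit) (C D R : clause) :
    wres k F C -> wres k F D ->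
    x \in lits C -> neg x \in lits D ->
    lits R = (lits C `\ x) `|` (lits D `\ neg x) ->
    (#|` lits C| <= k) || (#|` lits D| <= k) ->
    wres k F R.

Definition whd_unsat (F : clause_set) (h : nat) : Prop :=
  wres h F bot /\ forall j, wres j F bot -> h <= j.

Definition whd_max (F : clause_set) (h : nat) : Prop :=
  (exists phi, ~ satisfiable (apply phi F) /\ whd_unsat (apply phi F) h) /\
  (forall phi, ~ satisfiable (apply phi F) ->
     exists2 j, whd_unsat (apply phi F) j & j <= h).

(* The graph of the function [whd]: [whd F h] reads "whd(F) = h". *)
Definition whd (F : clause_set) (h : nat) : Prop :=
  [\/ F = fset0 /\ h = 0,
      ~ satisfiable F /\ whd_unsat F h |
      [/\ F <> fset0, satisfiable F & whd_max F h]].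

Definition WC (k : nat) (F : clause_set) : Prop :=
  exists2 h, whd F h & h <= k.

(** * Queries *)

Definition entails (F F' : clause_set) : Prop :=
  forall phi, total_on (vars F `|` vars F') phi ->
    satisfies phi F -> satisfies phi F'.

Definition CO (F : clause_set) : Prop := satisfiable F.

Definition CE (FC : clause_set * clause) : Prop := entails FC.1 [fset FC.2].

Definition VA (F : clause_set) : Prop :=
  forall phi, total_on (vars F) phi -> satisfies phi F.

Definition IM (Fphi : clause_set * passign) : Prop :=
  forall psi, extends Fphi.2 psi -> total_on (vars Fphi.1) psi ->
    satisfies psi Fphi.1.

Definition SE (FF : clause_set * clause_set) : Prop := entails FF.1 FF.2.

Definition EQ (FF : clause_set * clause_set) : Prop :=
  forall phi, total_on (vars FF.1 `|` vars FF.2) phi ->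
    satisfies phi FF.1 = satisfies phi FF.2.

Definition passign_of (V : {fset var}) (f : {ffun V -> bool}) : passign :=
  FinMap f.

(* The satisfying assignments with domain exactly [vars F]. *)
Definition models (F : clause_set) : {fset passign} :=
  [fset passign_of f | f in {: {ffun vars F -> bool}}
                     & satisfies (passign_of f) F].

(** * Model of computation

   First-order functional programs over binary trees, in the style of the
   languages WHILE and F of Jones, "Computability and Complexity from a
   Programming Perspective".  Time is the number of evaluation steps, every
   basic operation being charged one unit (trees are thought of as pointers to
   shared, immutable cells).  Leaves may carry an atom; the only operation on
   atoms is the equality test.  Variables are represented by atoms, so that
   the length of an encoded clause-set is linear in [ell F + 1], independently
   of how large the names of its variables are. *)

Inductive tree := Nil | Atom of nat | Cons of tree & tree.

Definition tree_of_bool (b : bool) : tree := if b then Cons Nil Nil else Nil.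

Definition hd_tree (d : tree) : tree := if d is Cons a _ then a else Nil.
Definition tl_tree (d : tree) : tree := if d is Cons _ a then a else Nil.
Definition atom_eq (d e : tree) : bool :=
  if (d, e) is (Atom a, Atom b) then a == b else false.

(* [EVar] and [ELet] use de Bruijn indices; [ECall f e] calls the [f]-th
   function of the program, all functions being unary. *)
Inductive expr :=
| EVar of nat
| ENil
| ECons of expr & expr
| EHd of expr
| ETl of expr
| EEq of expr & expr
| EIf of expr & expr & expr
| ELet of expr & expr
| ECall of nat & expr.

Definition program := seq expr.

(* [eval P env e d t]: [e] evaluates to [d] in exactly [t] steps. *)
Inductive eval (P : program) : seq tree -> expr -> tree -> nat -> Prop :=
| eval_var env i : eval P env (EVar i) (nth Nil env i) 1
| eval_nil env : eval P env ENil Nil 1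
| eval_cons env e1 e2 d1 d2 t1 t2 :
    eval P env e1 d1 t1 -> eval P env e2 d2 t2 ->
    eval P env (ECons e1 e2) (Cons d1 d2) (t1 + t2).+1
| eval_hd env e d t :
    eval P env e d t -> eval P env (EHd e) (hd_tree d) t.+1
| eval_tl env e d t :
    eval P env e d t -> eval P env (ETl e) (tl_tree d) t.+1
| eval_eq env e1 e2 d1 d2 t1 t2 :
    eval P env e1 d1 t1 -> eval P env e2 d2 t2 ->
    eval P env (EEq e1 e2) (tree_of_bool (atom_eq d1 d2)) (t1 + t2).+1
| eval_if_true env e1 e2 e3 d1 d t1 t :
    eval P env e1 d1 t1 -> d1 <> Nil -> eval P env e2 d t ->
    eval P env (EIf e1 e2 e3) d (t1 + t).+1
| eval_if_false env e1 e2 e3 d t1 t :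
    eval P env e1 Nil t1 -> eval P env e3 d t ->
    eval P env (EIf e1 e2 e3) d (t1 + t).+1
| eval_let env e1 e2 d1 d t1 t :
    eval P env e1 d1 t1 -> eval P (d1 :: env) e2 d t ->
    eval P env (ELet e1 e2) d (t1 + t).+1
| eval_call env f e d1 d t1 t :
    eval P env e d1 t1 -> eval P [:: d1] (nth ENil P f) d t ->
    eval P env (ECall f e) d (t1 + t).+1.

(* The first function of a program is its entry point. *)
Definition run (P : program) (input output : tree) (t : nat) : Prop :=
  eval P [:: input] (nth ENil P 0) output t.

(** * Encodings

   A finite set is encoded by any list of codes of its elements, in any order
   and without repetition, so encodings are relations. *)

Definition tree_of_seq (s : seq tree) : tree := foldr Cons Nil s.

Definition list_code (K : eqType) (code : K -> tree -> Prop) (A : {pred K})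
    (d : tree) : Prop :=
  exists (s : seq K) (ds : seq tree),
    [/\ uniq s, s =i A, List.Forall2 code s ds & d = tree_of_seq ds].

Definition pair_code (A B : Type) (codeA : A -> tree -> Prop)
    (codeB : B -> tree -> Prop) (x : A * B) (d : tree) : Prop :=
  exists a b, [/\ codeA x.1 a, codeB x.2 b & d = Cons a b].

Definition lit_code (x : lit) (d : tree) : Prop :=
  d = Cons (Atom x.1) (tree_of_bool x.2).

Definition clause_code (C : clause) : tree -> Prop :=
  list_code lit_code (mem (lits C)).

Definition clause_set_code (F : clause_set) : tree -> Prop :=
  list_code clause_code (mem F).

(* A partial assignment is encoded as the set of literals it makes true. *)
Definition passign_code (phi : passign) : tree -> Prop :=
  list_code lit_code (lit_true phi).

Definition models_code (F : clause_set) : tree -> Prop :=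
  list_code passign_code (mem (models F)).

(** * Polynomial time *)

(* The decision problem [Q] restricted to the inputs in [dom] is decidable in
   time polynomial in [size]. *)
Definition ptime_decidable (I : Type) (code : I -> tree -> Prop)
    (size : I -> nat) (dom Q : I -> Prop) : Prop :=
  exists (P : program) (p : {poly nat}),
    forall x, dom x -> forall d, code x d ->
      exists (b : bool) (t : nat),
        [/\ run P d (tree_of_bool b) t, t <= p.[size x]%R & b <-> Q x].

(* Enumeration of all models in time [p(ell F, m)], [m] being their number. *)
Definition ptime_enumerable_models (dom : clause_set -> Prop) : Prop :=
  exists (P : program) (p : {poly {poly nat}}),
    forall F, dom F -> forall d, clause_set_code F d ->
      exists (out : tree) (t : nat),
        [/\ run P d out t, models_code F out
          & t <= p.[((#|` models F|)%:P)%R].[ell F]%R].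

(* Main.v *)
(** For unsatisfiable [F] with [whd F <= k], an asymmetric-width refutation may
    contain clauses of unbounded length, so it cannot be searched for directly.
    Instead one saturates the set of implied clauses with at most [k + 1] literals:
    a clause is added when falsifying all its literals falsifies, literal by literal,
    some clause of [F] or some clause found before.  By induction on a refutation,
    each of its clauses [C] is refuted by unit propagation once its literals are set
    to false: in a resolution step the parent of length at most [k] has been found,
    hence propagates the resolved literal, and the conflict of the other parent carries
    over.  As the candidates are polynomially many, this decides unsatisfiability on
    [WC k], and also that of [phi * F], by adding the literals of [phi] as unit
    clauses.  CE, SE and EQ reduce to such tests; VA and IM are syntactic because
    clauses are never tautological; ME builds the models variable by variable,
    discarding the partial assignments without a model, so that no intermediate list
    is longer than the list of models.

    Programs are obtained from closure properties of the class of polynomial-time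
    functions, where [foldr] is the only recursion. *)

From Stdlib Require Classical_Prop.
Require Import Defs.
From mathcomp Require Import all_boot all_order all_algebra finmap.
From mathcomp Require Import zify.

Set Implicit Arguments.
Unset Strict Implicit.
Unset Printing Implicit Defensive.


(** * Polynomial bounds *)

(** The base is at least 2, so that a single exponent absorbs constants, factors and sums. *)
Definition dominated (A : Type) (mu q : A -> nat) : Prop :=
  exists c, forall a, q a <= (mu a).+2 ^ c.

Section Dominated.
Variables (A : Type) (mu : A -> nat).
Implicit Types q r : A -> nat.

Lemma dominated_const n : dominated mu (fun=> n).
Proof. by exists n => a; apply/ltnW/ltn_expl. Qed.

Lemma dominated_refl : dominated mu mu.
Proof. by exists 1 => a; rewrite expn1; lia. Qed.

Lemma dominatedW q r : (forall a, q a <= r a) -> dominated mu r -> dominated mu q.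
Proof. by move=> le_qr [c rP]; exists c => a; apply: leq_trans (le_qr a) _. Qed.

Lemma dominatedM q r :
  dominated mu q -> dominated mu r -> dominated mu (fun a => q a * r a).
Proof. by case=> c qP [c' rP]; exists (c + c') => a; rewrite expnD leq_mul. Qed.

Lemma dominatedD q r :
  dominated mu q -> dominated mu r -> dominated mu (fun a => q a + r a).
Proof.
(* One further factor, at least 2, pays for the sum of two powers. *)
move=> [c qP] [c' rP]; exists (c + c').+1 => a.
have le_exp i j : (mu a).+2 ^ i <= (mu a).+2 ^ (i + j).
  by rewrite leq_exp2l ?leq_addr.
have := le_exp c c'; have := le_exp c' c; rewrite [c' + c]addnC expnS.
by have := qP a; have := rP a; nia.
Qed.

Lemma dominatedS q : dominated mu q -> dominated mu (fun a => (q a).+1).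
Proof.
move=> qP; apply: (dominatedW (r := fun a => q a + 1)) => [a|]; first by lia.
by apply: dominatedD => //; apply: dominated_const.
Qed.

Lemma dominated_exp q c : dominated mu q -> dominated mu (fun a => q a ^ c).
Proof. case=> c' qP; exists (c' * c) => a; case: c => [|c]; first by rewrite muln0.
by rewrite expnM leq_exp2r.
Qed.

End Dominated.


(** * Linking programs *)

(* Calls beyond the end of a program return [Nil]; after relocation they must not
   reach the functions linked behind it. *)
Fixpoint relocate (n s : nat) (e : expr) : expr :=
  match e with
  | EVar i => EVar i
  | ENil => ENil
  | ECons e1 e2 => ECons (relocate n s e1) (relocate n s e2)
  | EHd e => EHd (relocate n s e)
  | ETl e => ETl (relocate n s e)
  | EEq e1 e2 => EEq (relocate n s e1) (relocate n s e2)
  | EIf e1 e2 e3 => EIf (relocate n s e1) (relocate n s e2) (relocate n s e3)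
  | ELet e1 e2 => ELet (relocate n s e1) (relocate n s e2)
  | ECall f e =>
    if f < s then ECall (n + f) (relocate n s e) else ELet (relocate n s e) ENil
  end.

Definition embedded (P Q : program) (n : nat) : Prop :=
  forall i, i < size P -> nth ENil Q (n + i) = relocate n (size P) (nth ENil P i).

Definition load (n : nat) (P : program) : program := map (relocate n (size P)) P.

(** The empty program has entry point [ENil], the default of [nth]; [ELet e ENil] reproduces the
    value and the cost of running it. *)
Definition call (n : nat) (P : program) (e : expr) : expr :=
  if 0 < size P then ECall n e else ELet e ENil.

Lemma embedded_load A P B : embedded P (A ++ load (size A) P ++ B) (size A).
Proof.
move=> i lt_iP; rewrite nth_cat ltnNge leq_addr addKn /= nth_cat size_map lt_iP.
by rewrite (nth_map ENil).
Qed.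

(** The time is preserved exactly: a call beyond the end runs the default body [ENil], and its
    replacement by [ELet] takes equally many steps. *)
Lemma eval_relocate P Q n : embedded P Q n ->
  forall env e d t, eval P env e d t -> eval Q env (relocate n (size P) e) d t.
Proof.
move=> PQ env e d t; elim=> /=; try by [econstructor; eauto].
move=> {}env f {}e d1 {}d t1 {}t _ ev1 _ ev2; case: ltnP => [lt_fP|le_Pf].
  by apply: eval_call; rewrite ?PQ //; eassumption.
move: ev2; rewrite nth_default //= => ev2; apply: (eval_let ev1).
by inversion ev2; apply: eval_nil.
Qed.

Lemma eval_linked P Q n env e d1 d t1 t : embedded P Q n ->
  eval Q env e d1 t1 -> run P d1 d t -> eval Q env (call n P e) d (t1 + t).+1.
Proof.
move=> PQ ev1 /(eval_relocate PQ); rewrite /call.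
case: posnP => [/size0nil ->|P_gt0] /= ev2.
  by apply: (eval_let ev1); inversion ev2; apply: eval_nil.
by apply: (eval_call ev1); rewrite -[n]addn0 PQ.
Qed.

(** * Functions computable with dominated time and output size *)

(** An atom counts one however large its number, in line with the unit cost of comparing atoms. *)
Fixpoint tree_size (d : tree) : nat :=
  if d is Defs.Cons a b then (tree_size a + tree_size b).+1 else 1.

(** Codes are functions here: a code of a finite set is the unique code of some list enumerating it.
    Natural numbers are names of variables, hence atoms. *)
Class Enc (A : Type) := enc : A -> tree.

#[export] Instance enc_bool : Enc bool := tree_of_bool.
#[export] Instance enc_nat : Enc nat := Atom.
#[export] Instance enc_pair A B `{Enc A} `{Enc B} : Enc (A * B) :=
  fun x => Defs.Cons (enc x.1) (enc x.2).
#[export] Instance enc_seq A `{Enc A} : Enc (seq A) :=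
  fun s => tree_of_seq (map enc s).

Arguments enc : simpl never.
Arguments tree_size : simpl never.

Lemma tree_size_pair A B `{Enc A} `{Enc B} (a : A) (b : B) :
  tree_size (enc (a, b)) = (tree_size (enc a) + tree_size (enc b)).+1.
Proof. by []. Qed.

Lemma tree_size_cons A `{Enc A} (a : A) s :
  tree_size (enc (a :: s)) = (tree_size (enc a) + tree_size (enc s)).+1.
Proof. by []. Qed.

(** The output size is bounded separately from the time, since sharing lets repeated [ECons x x]
    build a tree of exponential size in linear time. The measure is arbitrary because enumeration is
    also measured by the number of models. *)
Definition computable A B `{Enc A} `{Enc B} (mu : A -> nat) (f : A -> B) : Prop :=
  exists (P : program) (T : A -> nat),
    [/\ forall a, exists2 t, run P (enc a) (enc (f a)) t & t <= T a,
        dominated mu T & dominated mu (fun a => tree_size (enc (f a)))].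

Notation ptime f := (computable (fun a => tree_size (enc a)) f).

(** * Composition and pairing *)

Section Closure.
Context {A B C : Type} {eA : Enc A} {eB : Enc B} {eC : Enc C}.

Lemma computable_comp (mu : A -> nat) (nu : B -> nat) (f : A -> B) (g : B -> C) :
  computable mu f -> computable nu g -> dominated mu (fun a => nu (f a)) ->
  computable mu (fun a => g (f a)).
Proof.
move=> [P [T [PT T_le f_le]]] [Q [T' [QT [c T'_le] [c' g_le]]]] nu_le.
have pull i : dominated mu (fun a => (nu (f a)).+2 ^ i).
  by apply/dominated_exp/dominatedS/dominatedS.
(* The entry point occupies position 0; [P] is loaded at 1 and [Q] right behind it. *)
exists (call (1 + size P) Q (call 1 P (EVar 0)) ::
        load 1 P ++ load (1 + size P) Q), (fun a => (1 + T a + T' (f a)).+2).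
split=> [a||]; last exact: (dominatedW (fun a => g_le (f a))).
  have [t1 ev1 le1] := PT a; have [t2 ev2 le2] := QT (f a).
  exists (((1 + t1).+1 + t2).+1); last by lia.
  set R := (X in run X).
  have PR : embedded P R 1 by apply: (embedded_load [:: _]).
  have QR : embedded Q R (1 + size P).
    have := @embedded_load (call (1 + size P) Q (call 1 P (EVar 0)) :: load 1 P) Q [::].
    by rewrite cats0 /= size_map.
  by rewrite /run /=; apply: (eval_linked QR) ev2; apply: (eval_linked PR) ev1;
    apply: eval_var.
apply/dominatedS/dominatedS/dominatedD; first exact/dominatedS.
exact: (dominatedW (fun a => T'_le (f a))).
Qed.

Lemma ptime_comp (f : A -> B) (g : B -> C) :
  ptime f -> ptime g -> ptime (fun a => g (f a)).
Proof.
by move=> fP gP; apply: (computable_comp fP gP); case: fP => [P [T []]].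
Qed.

Lemma ptime_id : ptime (fun a : A => a).
Proof.
exists [:: EVar 0], (fun=> 1); split=> [a||].
- by exists 1 => //; apply: eval_var.
- exact: dominated_const.
- exact: dominated_refl.
Qed.

Lemma ptime_pair (f : A -> B) (g : A -> C) :
  ptime f -> ptime g -> ptime (fun a => (f a, g a)).
Proof.
move=> [P [T [PT T_le f_le]]] [Q [T' [QT T'_le g_le]]].
exists (ECons (call 1 P (EVar 0)) (call (1 + size P) Q (EVar 0)) ::
        load 1 P ++ load (1 + size P) Q), (fun a => ((T a).+2 + (T' a).+2).+1).
split=> [a||]; last by apply/dominatedS/dominatedD.
  have [t1 ev1 le1] := PT a; have [t2 ev2 le2] := QT a.
  exists (((1 + t1).+1 + (1 + t2).+1).+1); last by lia.
  set R := (X in run X).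
  have PR : embedded P R 1 by apply: (embedded_load [:: _]).
  have QR : embedded Q R (1 + size P).
    have := @embedded_load (ECons (call 1 P (EVar 0)) (call (1 + size P) Q (EVar 0))
                              :: load 1 P) Q [::].
    by rewrite cats0 /= size_map.
  rewrite /run /=; apply: eval_cons.
    by apply: (eval_linked PR) ev1; apply: eval_var.
  by apply: (eval_linked QR) ev2; apply: eval_var.
by apply/dominatedS/dominatedD; apply/dominatedS/dominatedS.
Qed.

Lemma ptime_expr (e : expr) (n c : nat) (f : A -> B) :
  (forall a, eval [:: e] [:: enc a] e (enc (f a)) n) ->
  (forall a, tree_size (enc (f a)) <= tree_size (enc a) + c) -> ptime f.
Proof.
move=> ev le; exists [:: e], (fun=> n); split=> [a||].
- by exists n => //; apply: ev.
- exact: dominated_const.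
- by apply: (dominatedW le); apply: dominatedD;
    [apply: dominated_refl | apply: dominated_const].
Qed.

End Closure.

(** * Basic operations on pairs, lists, booleans and atoms *)

Section Primitives.
Context {A B C : Type} {eA : Enc A} {eB : Enc B} {eC : Enc C}.

Lemma ptime_fst (f : A -> B * C) : ptime f -> ptime (fun a => (f a).1).
Proof.
move=> fP; apply: (ptime_comp (g := fst) fP).
apply: (ptime_expr (e := EHd (EVar 0)) (n := 2) (c := 0)) => [[b c]|[b c]] /=.
  exact: (eval_hd (eval_var _ _ _)).
by rewrite tree_size_pair addn0; apply/ltnW; rewrite ltnS leq_addr.
Qed.

Lemma ptime_snd (f : A -> B * C) : ptime f -> ptime (fun a => (f a).2).
Proof.
move=> fP; apply: (ptime_comp (g := snd) fP).
apply: (ptime_expr (e := ETl (EVar 0)) (n := 2) (c := 0)) => [[b c]|[b c]] /=.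
  exact: (eval_tl (eval_var _ _ _)).
by rewrite tree_size_pair addn0; apply/ltnW; rewrite ltnS leq_addl.
Qed.

Lemma ptime_nil : ptime (fun _ : A => [::] : seq B).
Proof.
by apply: (ptime_expr (e := ENil) (n := 1) (c := 1)) => a /=;
  [apply: eval_nil | apply: leq_addl].
Qed.

(** A nonempty list has the same code as the pair of its head and tail, so the program is the
    identity. *)
Lemma ptime_cons (f : A -> B) (g : A -> seq B) :
  ptime f -> ptime g -> ptime (fun a => f a :: g a).
Proof.
move=> fP gP; apply: (ptime_comp (g := fun x => x.1 :: x.2) (ptime_pair fP gP)).
apply: (ptime_expr (e := EVar 0) (n := 1) (c := 0)) => [[b s]|[b s]] /=.
  exact: eval_var.
by rewrite addn0.
Qed.

Lemma ptime_bool (b : bool) : ptime (fun _ : A => b).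
Proof.
apply: (ptime_expr (e := if b then ECons ENil ENil else ENil)
                   (n := if b then 3 else 1) (c := 3)) => a.
  by case: b; [apply: (eval_cons (eval_nil _ _) (eval_nil _ _)) | apply: eval_nil].
by apply: leq_trans (leq_addl _ _); case: b.
Qed.

Lemma ptime_eqn (f g : A -> nat) :
  ptime f -> ptime g -> ptime (fun a => f a == g a).
Proof.
move=> fP gP; apply: (ptime_comp (g := fun x => x.1 == x.2) (ptime_pair fP gP)).
apply: (ptime_expr (e := EEq (EHd (EVar 0)) (ETl (EVar 0))) (n := 5) (c := 0)).
  case=> i j; apply: (eval_eq (eval_hd (eval_var _ _ _)) (eval_tl (eval_var _ _ _))).
by case=> i j /=; rewrite tree_size_pair; case: eqP.
Qed.

(** Both branches are computed before the test, which polynomial time allows; the conditional is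
    then one expression on a triple. *)
Lemma ptime_if (f : A -> bool) (g h : A -> B) :
  ptime f -> ptime g -> ptime h -> ptime (fun a => if f a then g a else h a).
Proof.
move=> fP gP hP; apply: (ptime_comp (g := fun x => if x.1 then x.2.1 else x.2.2)
  (ptime_pair fP (ptime_pair gP hP))).
pose e := EIf (EHd (EVar 0)) (EHd (ETl (EVar 0))) (ETl (ETl (EVar 0))).
apply: (ptime_expr (e := e) (n := (2 + 3).+1) (c := 0)).
  case=> [[] [b b']].
    apply: (@eval_if_true _ _ _ _ _ (tree_of_bool true)) => //.
      exact: (eval_hd (eval_var _ _ _)).
    exact: (eval_hd (eval_tl (eval_var _ _ _))).
  apply: eval_if_false; first exact: (eval_hd (eval_var _ _ _)).
  exact: (eval_tl (eval_tl (eval_var _ _ _))).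
by case=> [[] [b b']]; rewrite !tree_size_pair /=; lia.
Qed.

End Primitives.

(** * Recursion along a list *)

Section Foldr.
Context {A B E : Type} {eA : Enc A} {eB : Enc B} {eE : Enc E}.
Variable g : E -> A -> B -> B.

(** The sizes of all intermediate accumulators enter the measure, because a polynomial-time step may
    double the accumulator each time. *)
Fixpoint foldr_size (e : E) (b : B) (s : seq A) : nat :=
  tree_size (enc (foldr (g e) b s)) + (if s is _ :: s' then foldr_size e b s' else 0).

Lemma foldr_size_le e b s m :
  (forall s1 s2, s = s1 ++ s2 -> tree_size (enc (foldr (g e) b s2)) <= m) ->
  foldr_size e b s <= (size s).+1 * m.
Proof.
elim: s => [|a s IHs] le_m /=; first by rewrite addn0 mul1n (le_m [::] [::]).
rewrite mulSn leq_add ?(le_m [::] (a :: s)) // IHs // => s1 s2 def_s.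
by apply: (le_m (a :: s1)); rewrite def_s.
Qed.

(** [x] is the code of [(e, (b, s))]. Function 0 calls itself on the tail of [s] and passes the
    result, with [e] and the head of [s], to [P]. *)
Definition foldr_prog (P : program) : program :=
  let x := EVar 0 in let s := ETl (ETl x) in
  EIf s
    (call 1 P (ECons (ECons (EHd x)
       (ECall 0 (ECons (EHd x) (ECons (EHd (ETl x)) (ETl s))))) (EHd s)))
    (EHd (ETl x))
  :: load 1 P.

Lemma size_le_tree_size (s : seq A) : size s < tree_size (enc s).
Proof. by elim: s => [|a s IHs] //; rewrite tree_size_cons /=; lia. Qed.

Lemma computable_foldr :
  ptime (fun x : (E * B) * A => g x.1.1 x.2 x.1.2) ->
  computable (fun x : E * (B * seq A) =>
                tree_size (enc x) + foldr_size x.1 x.2.1 x.2.2)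
             (fun x => foldr (g x.1) x.2.1 x.2.2).
Proof.
move=> [P [T [PT [c T_le] _]]].
rewrite /computable; set mu := (X in dominated X _); exists (foldr_prog P).
(* Per list cell, 40 generously covers the projections and constructions, and the power covers one
   run of [P]. *)
exists (fun x => (size x.2.2).+1 * (40 + (mu x).+2 ^ c)); split; last first.
- by apply: dominatedW (dominated_refl _) => -[e [b [|a s]]]; rewrite /mu /=; lia.
- apply: dominatedM; last first.
    apply: dominatedD; first exact: dominated_const.
    exact/dominated_exp/dominatedS/dominatedS/dominated_refl.
  apply: dominatedW (dominated_refl _) => -[e [b s]]; rewrite /mu /=.
  by rewrite !tree_size_pair; have := size_le_tree_size s; lia.
have PR : embedded P (foldr_prog P) 1.
  by rewrite /foldr_prog -[load 1 P]cats0; apply: (embedded_load [:: _]).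
case=> e [b s] /=; have := leqnn (mu (e, (b, s))).
(* The measure of the whole input is fixed as [m] before the induction, so that every level has the
   same bound. *)
move: {2 3}(mu _) => m; elim: s => [|a s IHs] le_m.
  eexists.
    rewrite /run /=; apply: eval_if_false.
      exact: (eval_tl (eval_tl (eval_var _ _ _))).
    exact: (eval_hd (eval_tl (eval_var _ _ _))).
  by rewrite mul1n leq_addr.
have [|t1 ev1 le1] := IHs; first by
  by move: le_m; rewrite /mu /= !(tree_size_pair e) !(tree_size_pair b) tree_size_cons; lia.
have [t2 ev2 le2] := PT ((e, foldr (g e) b s), a).
eexists.
  rewrite /run /=; apply: eval_if_true.
  - exact: (eval_tl (eval_tl (eval_var _ _ _))).
  - by [].
  apply: (eval_linked PR) ev2; apply: eval_cons.
    apply: eval_cons; first exact: (eval_hd (eval_var _ _ _)).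
    apply: eval_call ev1; apply: eval_cons; first exact: (eval_hd (eval_var _ _ _)).
    apply: eval_cons; first exact: (eval_hd (eval_tl (eval_var _ _ _))).
    exact: (eval_tl (eval_tl (eval_tl (eval_var _ _ _)))).
  exact: (eval_hd (eval_tl (eval_tl (eval_var _ _ _)))).
have : T (e, foldr (g e) b s, a) <= m.+2 ^ c.
  apply: leq_trans (T_le _) _; case: (c) => // c'; rewrite leq_exp2r //.
  move: le_m; rewrite /mu /= (tree_size_pair (e, _)) !(tree_size_pair e) (tree_size_pair b).
  by rewrite tree_size_cons; case: (s) => [|a' s'] /=; lia.
rewrite mulSn; move: (_ * _) le1 => M; lia.
Qed.

(** Bounded recursion in the style of Cobham: one dominated bound [q] on the accumulators of all
    suffixes bounds [foldr_size] by [q] times the length plus one. *)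
Lemma ptime_foldr (s : E -> seq A) (b : E -> B) (q : E -> nat) :
  ptime (fun x : (E * B) * A => g x.1.1 x.2 x.1.2) -> ptime s -> ptime b ->
  dominated (fun e => tree_size (enc e)) q ->
  (forall e s1 s2, s e = s1 ++ s2 -> tree_size (enc (foldr (g e) (b e) s2)) <= q e) ->
  ptime (fun e => foldr (g e) (b e) (s e)).
Proof.
move=> gP sP bP q_dom q_le.
have iP : ptime (fun e => (e, (b e, s e))).
  by apply: ptime_pair; [apply: ptime_id | apply: ptime_pair].
apply: (computable_comp iP (computable_foldr gP)) => /=.
apply: dominatedD; first by case: iP => [P [T []]].
apply: (dominatedW (fun e => foldr_size_le (@q_le e))).
apply: dominatedM q_dom; case: sP => [P [T [_ _]]]; apply: dominatedW => e.
exact: size_le_tree_size.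
Qed.

End Foldr.


(** * Polynomial-time list operations *)

Lemma tree_size_cat A `{Enc A} (s t : seq A) :
  (tree_size (enc (s ++ t))).+1 = tree_size (enc s) + tree_size (enc t).
Proof. by elim: s => //= a s IHs; rewrite !tree_size_cons; lia. Qed.

Lemma tree_size_suffix A `{Enc A} (s s1 s2 : seq A) :
  s = s1 ++ s2 -> tree_size (enc s2) <= tree_size (enc s).
Proof.
move=> ->; generalize (tree_size_cat s1 s2) (size_le_tree_size s1); lia.
 Qed.

Lemma tree_size_flatten A `{Enc A} (ss : seq (seq A)) :
  tree_size (enc (flatten ss)) <= tree_size (enc ss).
Proof.
elim: ss => //= s ss IHss; generalize (tree_size_cat s (flatten ss)).
by rewrite tree_size_cons; lia.
Qed.

Lemma tree_size_filter A `{Enc A} (p : pred A) (s : seq A) :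
  tree_size (enc (filter p s)) <= tree_size (enc s).
Proof. by elim: s => //= a s IHs; case: (p a); rewrite !tree_size_cons; lia. Qed.

Lemma tree_size_map A B `{Enc A} `{Enc B} (h : A -> B) (s : seq A) (m n : nat) :
    tree_size (enc s) <= m ->
    (forall a, tree_size (enc a) <= m -> tree_size (enc (h a)) <= n) ->
  tree_size (enc (map h s)) <= size s * n.+1 + 1.
Proof.
move=> + hP; elim: s => [|a s IHs] //; rewrite tree_size_cons /= tree_size_cons mulSn => le_m.
by have := hP a; have := IHs; lia.
Qed.

Section Composition.
Context {A B C E : Type} {eA : Enc A} {eB : Enc B} {eC : Enc C} {eE : Enc E}.

Lemma ptime_ext (f g : E -> A) : f =1 g -> ptime f -> ptime g.
Proof.
move=> fg [P [T [PT T_le f_le]]]; exists P, T; split=> //.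
  by move=> e; rewrite -fg.
by apply: dominatedW f_le => e; rewrite fg.
Qed.

Lemma ptime_size (f : E -> A) :
  ptime f -> dominated (fun e => tree_size (enc e)) (fun e => tree_size (enc (f e))).
Proof. by case=> [P [T []]]. Qed.

Lemma ptime_app2 (f : A -> B -> C) (g : E -> A) (h : E -> B) :
  ptime (fun x => f x.1 x.2) -> ptime g -> ptime h -> ptime (fun e => f (g e) (h e)).
Proof.
by move=> fP gP hP; apply: (ptime_comp (g := fun x => f x.1 x.2) (ptime_pair gP hP)).
Qed.

End Composition.

Section Booleans.
Context {E : Type} {eE : Enc E}.

Lemma ptime_negb (p : E -> bool) : ptime p -> ptime (fun e => ~~ p e).
Proof. by move=> pP; apply: (ptime_if pP); apply: ptime_bool. Qed.

Lemma ptime_andb (p q : E -> bool) :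
  ptime p -> ptime q -> ptime (fun e => p e && q e).
Proof. by move=> pP qP; apply: (ptime_if pP qP (ptime_bool _)). Qed.

Lemma ptime_orb (p q : E -> bool) :
  ptime p -> ptime q -> ptime (fun e => p e || q e).
Proof. by move=> pP qP; apply: (ptime_if pP (ptime_bool _) qP). Qed.

Lemma ptime_eqb (p q : E -> bool) :
  ptime p -> ptime q -> ptime (fun e => p e == q e).
Proof.
move=> pP qP; apply: ptime_ext (ptime_if pP qP (ptime_negb qP)) => e.
by case: (p e) (q e) => [] [].
Qed.

End Booleans.

Section Lists.
Context {A B E : Type} {eA : Enc A} {eB : Enc B} {eE : Enc E}.

Lemma ptime_has (p : E -> A -> bool) (s : E -> seq A) :
  ptime (fun x => p x.1 x.2) -> ptime s -> ptime (fun e => has (p e) (s e)).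
Proof.
move=> pP sP; apply: (ptime_ext (f := fun e => foldr (fun a b => p e a || b) false (s e))).
  by move=> e; elim: (s e) => //= a t ->.
(* 3 is the size of the code of [true]. *)
apply: (ptime_foldr (g := fun e a b => p e a || b) (q := fun=> 3)) => //.
- apply: ptime_orb; last by apply/ptime_snd/ptime_fst/ptime_id.
  apply: (ptime_app2 pP); first by apply/ptime_fst/ptime_fst/ptime_id.
  exact/ptime_snd/ptime_id.
- exact: ptime_bool.
- exact: dominated_const.
- by move=> e s1 s2 _; case: (foldr _ _ _).
Qed.

Lemma ptime_all (p : E -> A -> bool) (s : E -> seq A) :
  ptime (fun x => p x.1 x.2) -> ptime s -> ptime (fun e => all (p e) (s e)).
Proof.
move=> pP sP; apply: (ptime_ext (f := fun e => ~~ has (fun a => ~~ p e a) (s e))).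
  by move=> e; rewrite -all_predC; apply: eq_all => a /=; rewrite negbK.
by apply: ptime_negb; apply: ptime_has => //; apply: ptime_negb.
Qed.

Lemma ptime_nilp (s : E -> seq A) : ptime s -> ptime (fun e => nilp (s e)).
Proof.
move=> sP; apply: (ptime_ext (f := fun e => ~~ has xpredT (s e))) => [e|].
  by case: (s e).
by apply: ptime_negb; apply: ptime_has => //; apply: ptime_bool.
Qed.

Lemma ptime_map (h : E -> A -> B) (s : E -> seq A) :
  ptime (fun x => h x.1 x.2) -> ptime s -> ptime (fun e => map (h e) (s e)).
Proof.
move=> hP sP; have [c h_le] := ptime_size hP.
(* An element of [s e] is no larger than [s e], so [n] bounds the size of every image. *)
pose (n := fun e => ((tree_size (enc e) + tree_size (enc (s e))).+1).+2 ^ c).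
have mapE e t : foldr (fun a t => h e a :: t) [::] t = map (h e) t.
  by elim: t => //= a t ->.
apply: (ptime_ext (fun e => mapE e (s e))).
apply: (ptime_foldr (g := fun e a t => h e a :: t)
                    (q := fun e => tree_size (enc (s e)) * (n e).+1 + 1)) => //.
- apply: ptime_cons; last by apply/ptime_snd/ptime_fst/ptime_id.
  apply: (ptime_app2 hP); first by apply/ptime_fst/ptime_fst/ptime_id.
  exact/ptime_snd/ptime_id.
- exact: ptime_nil.
- apply: dominatedD (dominated_const _ _); apply: dominatedM; first exact: ptime_size.
  apply/dominatedS/dominated_exp/dominatedS/dominatedS/dominatedS/dominatedD.
    exact: dominated_refl.
  exact: ptime_size.
- move=> e s1 s2 def_s; pose proof (tree_size_suffix def_s) as le2.
  rewrite mapE; refine (leq_trans (tree_size_map (n := n e) le2 _) _) => [a le_a|].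
    apply: leq_trans (h_le (e, a)) _; rewrite /n; case: (c) => // c'.
    by rewrite leq_exp2r // tree_size_pair; lia.
  rewrite leq_add2r leq_mul2r; generalize (size_le_tree_size s2); lia.
Qed.

Lemma ptime_filter (p : E -> A -> bool) (s : E -> seq A) :
  ptime (fun x => p x.1 x.2) -> ptime s -> ptime (fun e => filter (p e) (s e)).
Proof.
move=> pP sP; pose g e a t := if p e a then a :: t else t.
apply: (ptime_ext (f := fun e => foldr (g e) [::] (s e))) => [e|].
  by rewrite /g; elim: (s e) => //= a t ->.
refine (ptime_foldr (q := fun e => tree_size (enc (s e))) _ _ _ _ _) => //; rewrite /g.
- apply: ptime_if; last by apply/ptime_snd/ptime_fst/ptime_id.
    apply: (ptime_app2 pP); first by apply/ptime_fst/ptime_fst/ptime_id.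
    exact/ptime_snd/ptime_id.
  by apply: ptime_cons; [apply/ptime_snd/ptime_id | apply/ptime_snd/ptime_fst/ptime_id].
- exact: ptime_nil.
- exact: ptime_size.
- move=> e s1 s2 def_s; apply: leq_trans (tree_size_suffix def_s).
  suff ->: foldr (fun a t => if p e a then a :: t else t) [::] s2 = filter (p e) s2.
    exact: tree_size_filter.
  by elim: (s2) => //= a t ->.
Qed.

Lemma ptime_cat (s t : E -> seq A) : ptime s -> ptime t -> ptime (fun e => s e ++ t e).
Proof.
have catE (u v : seq A) : foldr cons v u = u ++ v by elim: u => //= a u ->.
move=> sP tP; apply: (ptime_ext (fun e => catE (s e) (t e))).
refine (ptime_foldr (g := fun=> cons)
  (q := fun e => tree_size (enc (s e)) + tree_size (enc (t e))) _ _ _ _ _) => //.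
- by apply: ptime_cons; [apply/ptime_snd/ptime_id | apply/ptime_snd/ptime_fst/ptime_id].
- by apply: dominatedD; apply: ptime_size.
- move=> e s1 s2 /tree_size_suffix; generalize (tree_size_cat s2 (t e)); rewrite catE; lia.
Qed.

End Lists.

Section NestedLists.
Context {A B E : Type} {eA : Enc A} {eB : Enc B} {eE : Enc E}.

Lemma ptime_flatten (s : E -> seq (seq A)) : ptime s -> ptime (fun e => flatten (s e)).
Proof.
move=> sP.
refine (ptime_foldr (g := fun=> cat)
  (q := fun e => tree_size (enc (s e))) _ _ _ _ _) => //.
- by apply: ptime_cat; [apply/ptime_snd/ptime_id | apply/ptime_snd/ptime_fst/ptime_id].
- exact: ptime_nil.
- exact: ptime_size.
- by move=> e s1 s2 /tree_size_suffix; apply: leq_trans; apply: tree_size_flatten.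
Qed.

(** The list [s e] serves as a clock. Since [q] bounds [f] on every argument, no iterate grows
    beyond it. *)
Lemma ptime_iter (f : E -> seq A -> seq A) (s : E -> seq B) (q : E -> nat) :
  ptime (fun x => f x.1 x.2) -> ptime s ->
  dominated (fun e => tree_size (enc e)) q ->
  (forall e t, tree_size (enc (f e t)) <= q e) ->
  ptime (fun e => iter (size (s e)) (f e) [::]).
Proof.
move=> fP sP q_dom q_le.
have iterE e (t : seq B) : iter (size t) (f e) [::] = foldr (fun=> f e) [::] t.
  by elim: t => //= b t ->.
apply: (ptime_ext (fun e => esym (iterE e (s e)))).
apply: (ptime_foldr (g := fun e _ => f e) (q := fun e => (q e).+1)) => //.
- apply: (ptime_app2 fP); first by apply/ptime_fst/ptime_fst/ptime_id.
  exact/ptime_snd/ptime_fst/ptime_id.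
- exact: ptime_nil.
- exact: dominatedS.
- by move=> e s1 [|b s2] _ //=; apply: leqW.
Qed.

End NestedLists.

Lemma ptime_mem (A : eqType) (E : Type) `{Enc A} `{Enc E} (a : E -> A) (s : E -> seq A) :
    ptime (fun x : A * A => x.1 == x.2) -> ptime a -> ptime s ->
  ptime (fun e => a e \in s e).
Proof.
move=> eqP aP sP; apply: (ptime_ext (f := fun e => has (fun b => b == a e) (s e))).
  by move=> e; rewrite has_pred1.
apply: ptime_has => //; apply: (ptime_app2 (f := fun b c : A => b == c) eqP).
  exact/ptime_snd/ptime_id.
by apply: (ptime_comp _ aP); apply/ptime_fst/ptime_id.
Qed.

Lemma ptime_undup (A : eqType) (E : Type) `{Enc A} `{Enc E} (s : E -> seq A) :
    ptime (fun x : A * A => x.1 == x.2) -> ptime s -> ptime (fun e => undup (s e)).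
Proof.
move=> eqP sP; pose g (e : E) (a : A) (t : seq A) := if a \in t then t else a :: t.
have gE e t : foldr (g e) [::] t = undup t.
  by elim: t => //= a t ->; rewrite /g mem_undup.
apply: (ptime_ext (fun e => gE e (s e))).
refine (ptime_foldr (q := fun e => tree_size (enc (s e))) _ _ _ _ _) => //; rewrite /g.
- have [aP tP] : ptime (fun x : E * seq A * A => x.2) /\
                 ptime (fun x : E * seq A * A => x.1.2).
    by split; [apply/ptime_snd/ptime_id | apply/ptime_snd/ptime_fst/ptime_id].
  by apply: ptime_if => //; [apply: ptime_mem | apply: ptime_cons].
- exact: ptime_nil.
- exact: ptime_size.
- move=> e s1 s2 /tree_size_suffix; apply: leq_trans.
  rewrite -/(g e) gE; elim: (s2) => //= a t IHt.
  by case: (a \in t); rewrite !tree_size_cons; lia.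
Qed.

Lemma ptime_eq_lit : ptime (fun x : (nat * bool) * (nat * bool) => x.1 == x.2).
Proof.
apply: (@ptime_andb _ _ (fun x : (nat * bool) * (nat * bool) => x.1.1 == x.2.1)
                        (fun x => x.1.2 == x.2.2)).
  by apply: ptime_eqn; [apply/ptime_fst/ptime_fst/ptime_id
                       | apply/ptime_fst/ptime_snd/ptime_id].
by apply: ptime_eqb; [apply/ptime_snd/ptime_fst/ptime_id
                     | apply/ptime_snd/ptime_snd/ptime_id].
Qed.


(** * The refutation procedure *)

#[export] Instance enc_lit : Enc lit := @enc_pair nat bool _ _.

Section Procedure.
Implicit Types (G T : seq (seq lit)) (X L phi : seq lit) (y : lit).

(* [T] consists of implied clauses, which need not contain [neg y :: X] itself but
   only a clause subsuming it. *)
Definition falsified T X y : bool :=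
  (y \in X) || has (all (fun z => z \in neg y :: X)) T.

Definition rule G T X : bool := has (all (falsified T X)) (G ++ T).

Definition literals G : seq lit := flatten G ++ map neg (flatten G).

Fixpoint lists_upto L (n : nat) : seq (seq lit) :=
  if n is n'.+1 then
    lists_upto L n' ++ flatten [seq [seq x :: X | X <- lists_upto L n'] | x <- L]
  else [:: [::]].

(* Length [k + 1] is needed to record that falsifying a clause of length [k]
   falsifies one more literal. *)
Definition candidates (k : nat) G := lists_upto (literals G) k.+1.

(** Filtering the fixed list of candidates, instead of appending to [T], keeps every iterate within
    the size of that list. *)
Definition derive (k : nat) G T := [seq X <- candidates k G | rule G T X].

Definition derived (k : nat) G := iter (size (candidates k G)) (derive k G) [::].

Definition refute (k : nat) G : bool := has (@nilp _) (derived k G).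

Definition units phi : seq (seq lit) := [seq [:: l] | l <- phi].

End Procedure.

Section ProcedureTime.
Context {E : Type} {eE : Enc E}.

Lemma ptime_neg (f : E -> lit) : ptime f -> ptime (fun e => neg (f e)).
Proof.
move=> fP.
refine (@ptime_pair _ _ _ _ _ _ (fun e => (f e).1) (fun e => ~~ (f e).2) _ _).
  exact: ptime_fst.
by apply: ptime_negb; apply: ptime_snd.
Qed.

Lemma ptime_mem_lit (f : E -> lit) (s : E -> seq lit) :
  ptime f -> ptime s -> ptime (fun e => f e \in s e).
Proof. by move=> fP sP; apply: ptime_mem ptime_eq_lit fP sP. Qed.

Lemma ptime_units (s : E -> seq lit) : ptime s -> ptime (fun e => units (s e)).
Proof.
move=> sP; refine (ptime_map (h := fun _ l => [:: l]) _ sP).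
by apply: ptime_cons; [apply/ptime_snd/ptime_id | apply: ptime_nil].
Qed.
End ProcedureTime.

Lemma ptime_falsified :
  ptime (fun x : seq (seq lit) * seq lit * lit => falsified x.1.1 x.1.2 x.2).
Proof.
apply: ptime_orb.
  by apply: ptime_mem_lit; [apply/ptime_snd/ptime_id | apply/ptime_snd/ptime_fst/ptime_id].
refine (ptime_has (p := fun x => all (fun z => z \in neg x.2 :: x.1.2)) _ _); last first.
  exact/ptime_fst/ptime_fst/ptime_id.
refine (ptime_all (p := fun x z => z \in neg x.1.2 :: x.1.1.2) _ _); last first.
  exact/ptime_snd/ptime_id.
apply: ptime_mem_lit; first exact/ptime_snd/ptime_id.
apply: ptime_cons; first exact/ptime_neg/ptime_snd/ptime_fst/ptime_fst/ptime_id.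
exact/ptime_snd/ptime_fst/ptime_fst/ptime_fst/ptime_id.
Qed.

Lemma ptime_rule :
  ptime (fun x : seq (seq lit) * seq (seq lit) * seq lit => rule x.1.1 x.1.2 x.2).
Proof.
refine (ptime_has (p := fun x => all (falsified x.1.2 x.2)) _ _); last first.
  by apply: ptime_cat; [apply/ptime_fst/ptime_fst/ptime_id
                       | apply/ptime_snd/ptime_fst/ptime_id].
refine (ptime_all (p := fun x => falsified x.1.1.2 x.1.2) _ _); last first.
  exact/ptime_snd/ptime_id.
refine (ptime_comp (f := fun x : seq (seq lit) * seq (seq lit) * seq lit * seq lit * lit
  => (x.1.1.1.2, x.1.1.2, x.2)) _ ptime_falsified).
apply: ptime_pair; last exact/ptime_snd/ptime_id.
apply: ptime_pair; first exact/ptime_snd/ptime_fst/ptime_fst/ptime_fst/ptime_id.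
exact/ptime_snd/ptime_fst/ptime_fst/ptime_id.
Qed.

(** The length bound [n] is not an input: each [n] has its own program. This is where [k] has to be
    fixed. *)
Lemma ptime_lists_upto n : ptime (fun L : seq lit => lists_upto L n).
Proof.
elim: n => [|n IHn] /=; first by apply: ptime_cons; apply: ptime_nil.
apply: ptime_cat => //; apply: ptime_flatten.
refine (ptime_map (h := fun L x => [seq x :: X | X <- lists_upto L n]) _ _).
  2: exact: ptime_id.
refine (ptime_map (h := fun x X => x.2 :: X) _ _).
  by apply: ptime_cons; [apply/ptime_snd/ptime_fst/ptime_id | apply/ptime_snd/ptime_id].
by refine (ptime_comp _ IHn); apply/ptime_fst/ptime_id.
Qed.

Lemma ptime_candidates k : ptime (candidates k).
Proof.
refine (ptime_comp (f := literals) _ (ptime_lists_upto k.+1)).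
have fP : ptime (fun G : seq (seq lit) => flatten G) by apply/ptime_flatten/ptime_id.
apply: ptime_cat => //.
by refine (ptime_map (h := fun=> neg) _ _) => //; apply/ptime_neg/ptime_snd/ptime_id.
Qed.

Lemma ptime_derived k : ptime (derived k).
Proof.
refine (ptime_iter (f := derive k) (q := fun G => tree_size (enc (candidates k G))) _ _ _ _).
- refine (ptime_filter (p := fun x => rule x.1 x.2) ptime_rule _).
  by refine (ptime_comp _ (ptime_candidates k)); apply/ptime_fst/ptime_id.
- exact: ptime_candidates.
- exact/ptime_size/ptime_candidates.
- by move=> G T; apply: tree_size_filter.
Qed.

Lemma ptime_refute k : ptime (refute k).
Proof.
refine (ptime_has (p := fun=> @nilp lit) _ (ptime_derived k)).
exact/ptime_nilp/ptime_snd/ptime_id.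
Qed.

(** * Deciding the queries *)

(** A clause is entailed iff adding the negations of its literals as unit clauses destroys
    satisfiability. *)
Definition entails_alg (k : nat) (x : seq (seq lit) * seq lit) : bool :=
  refute k (x.1 ++ units (map neg x.2)).

Definition entails_all_alg (k : nat) (x : seq (seq lit) * seq (seq lit)) : bool :=
  all (fun C => entails_alg k (x.1, C)) x.2.

Definition implicant_alg (x : seq (seq lit) * seq lit) : bool :=
  all (has (fun l => l \in x.2)) x.1.

Lemma ptime_entails_alg k : ptime (entails_alg k).
Proof.
refine (ptime_comp (f := fun x : seq (seq lit) * seq lit => x.1 ++ units (map neg x.2))
          _ (ptime_refute k)).
apply: ptime_cat; first exact/ptime_fst/ptime_id.
apply: ptime_units; refine (ptime_map (h := fun=> neg) _ _).
  exact/ptime_neg/ptime_snd/ptime_id.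
exact/ptime_snd/ptime_id.
Qed.

Lemma ptime_entails_all_alg k : ptime (entails_all_alg k).
Proof.
refine (ptime_all (p := fun x C => entails_alg k (x.1, C)) _ _); last first.
  exact/ptime_snd/ptime_id.
refine (ptime_comp _ (ptime_entails_alg k)); apply: ptime_pair.
  exact/ptime_fst/ptime_fst/ptime_id.
exact/ptime_snd/ptime_id.
Qed.

Lemma ptime_implicant_alg : ptime implicant_alg.
Proof.
refine (ptime_all (p := fun x => has (fun l => l \in x.2)) _ _); last first.
  exact/ptime_fst/ptime_id.
refine (ptime_has (p := fun x l => l \in x.1.2) _ _); last exact/ptime_snd/ptime_id.
apply: ptime_mem_lit; first exact/ptime_snd/ptime_id.
exact/ptime_snd/ptime_fst/ptime_fst/ptime_id.
Qed.

(** * Enumerating the models *)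

Definition variables (G : seq (seq lit)) : seq nat := undup (map fst (flatten G)).

Definition consistent_with (k : nat) (G : seq (seq lit)) (phis : seq (seq lit)) :=
  [seq phi <- phis | ~~ refute k (G ++ units phi)].

Definition branch (v : nat) (phis : seq (seq lit)) : seq (seq lit) :=
  map (cons (v, true)) phis ++ map (cons (v, false)) phis.

Definition enumerate_over (k : nat) (G : seq (seq lit)) (vs : seq nat) :=
  foldr (fun v phis => consistent_with k G (branch v phis))
        (consistent_with k G [:: [::]]) vs.

Definition enumerate (k : nat) (G : seq (seq lit)) :=
  enumerate_over k G (variables G).

Lemma ptime_variables : ptime variables.
Proof.
apply: ptime_undup.
  by apply: ptime_eqn; [apply/ptime_fst/ptime_id | apply/ptime_snd/ptime_id].
refine (ptime_map (h := fun=> fst) _ (ptime_flatten ptime_id)).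
exact/ptime_fst/ptime_snd/ptime_id.
Qed.

Lemma ptime_consistent_with k E `{Enc E} (f g : E -> seq (seq lit)) :
  ptime f -> ptime g -> ptime (fun e => consistent_with k (f e) (g e)).
Proof.
move=> fP gP; refine (ptime_filter (p := fun e phi => ~~ refute k (f e ++ units phi)) _ gP).
apply: ptime_negb; refine (ptime_comp _ (ptime_refute k)); apply: ptime_cat.
  by refine (ptime_comp _ fP); apply/ptime_fst/ptime_id.
exact/ptime_units/ptime_snd/ptime_id.
Qed.

Lemma ptime_branch E `{Enc E} (f : E -> nat) (g : E -> seq (seq lit)) :
  ptime f -> ptime g -> ptime (fun e => branch (f e) (g e)).
Proof.
move=> fP gP.
have bP b : ptime (fun e => map (cons ((f e, b) : lit)) (g e)).
  refine (ptime_map (h := fun e => cons ((f e, b) : lit)) _ gP).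
  apply: ptime_cons; last exact/ptime_snd/ptime_id.
  apply: ptime_pair; last exact: ptime_bool.
  by refine (ptime_comp _ fP); apply/ptime_fst/ptime_id.
exact: ptime_cat.
Qed.

(* The intermediate lists are polynomial in the number of models only, hence the
   measure. *)
Lemma computable_enumerate k (m : seq (seq lit) -> nat) :
    (forall G s vs, variables G = s ++ vs ->
       tree_size (enc (enumerate_over k G vs)) <= m G) ->
  computable (fun G => tree_size (enc G) + m G) (enumerate k).
Proof.
move=> m_le; pose (mu := fun G => tree_size (enc G) + m G).
pose step (G : seq (seq lit)) v phis := consistent_with k G (branch v phis).
have stepP : ptime (fun x : (seq (seq lit) * seq (seq lit)) * nat => step x.1.1 x.2 x.1.2).
  apply: ptime_consistent_with; first exact/ptime_fst/ptime_fst/ptime_id.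
  by apply: ptime_branch; [apply/ptime_snd/ptime_id | apply/ptime_snd/ptime_fst/ptime_id].
have iP : ptime (fun G => (G, (consistent_with k G [:: [::]], variables G))).
  apply: ptime_pair; first exact: ptime_id.
  apply: ptime_pair ptime_variables; apply: ptime_consistent_with; first exact: ptime_id.
  by apply: ptime_cons; apply: ptime_nil.
(* Bounds in the input size alone carry over to the larger measure [mu]. *)
have monoP (q : seq (seq lit) -> nat) :
    dominated (fun G => tree_size (enc G)) q -> dominated mu q.
  case=> c q_le; exists c => G; apply: leq_trans (q_le G) _.
  by case: c {q_le} => // c; rewrite leq_exp2r // !ltnS leq_addr.
have iP' : computable mu (fun G => (G, (consistent_with k G [:: [::]], variables G))).
  by case: iP => [P [T [PT T_le o_le]]]; exists P, T; split=> //; apply: monoP.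
refine (computable_comp iP' (computable_foldr stepP) _) => /=.
apply: dominatedD; first by apply: monoP; apply: ptime_size iP.
apply: (dominatedW (fun G => foldr_size_le (@m_le G))).
apply: dominatedM; last first.
  by apply: dominatedW (dominated_refl mu) => G; apply: leq_addl.
apply: monoP; apply: dominatedW (ptime_size ptime_variables) => G.
exact: size_le_tree_size.
Qed.


(** * Correctness of the refutation procedure *)

Lemma negK : involutive neg.
Proof. by case=> v b; rewrite /neg /= negbK. Qed.

Definition holds (beta : nat -> bool) (l : lit) : bool := beta l.1 == l.2.

Definition sat (beta : nat -> bool) (G : seq (seq lit)) : bool :=
  all (has (holds beta)) G.

Lemma holds_neg beta l : holds beta (neg l) = ~~ holds beta l.
Proof. by case: l => v b; rewrite /holds /=; case: (beta v); case: b. Qed.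

Lemma sat_units beta phi : sat beta (units phi) = all (holds beta) phi.
Proof. by rewrite /sat all_map; apply: eq_all => l /=; rewrite orbF. Qed.

(** * Soundness: derived clauses are implied *)

Section Soundness.
Variable beta : nat -> bool.

(** A clause of [T] inside [neg y :: X] has a true literal, and when [X] is false this can only be
    [neg y]. *)
Lemma falsified_sound T X y :
  sat beta T -> ~~ has (holds beta) X -> falsified T X y -> ~~ holds beta y.
Proof.
move=> /allP satT /hasPn nX /orP[/nX //|/hasP[t tT /allP t_sub]].
have /hasP[z zt hz] := satT _ tT.
move: (t_sub z zt); rewrite inE => /orP[/eqP def_z|/nX]; last by rewrite hz.
by rewrite -holds_neg -def_z.
Qed.

Lemma rule_sound G T X :
  sat beta G -> sat beta T -> rule G T X -> has (holds beta) X.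
Proof.
move=> satG satT /hasP[D]; rewrite mem_cat => DGT /allP fD; apply: contraT => nX.
have /hasP[y yD hy] : has (holds beta) D.
  by case/orP: DGT; [apply: (allP satG) | apply: (allP satT)].
by have := falsified_sound satT nX (fD y yD); rewrite hy.
Qed.

Lemma refute_sound k G : refute k G -> ~~ sat beta G.
Proof.
move=> ref; apply/negP => satG.
have satT : sat beta (derived k G).
  rewrite /derived; elim: (size _) => //= n IHn; apply/allP => X.
  by rewrite mem_filter => /andP[/(rule_sound satG IHn)].
by case/hasP: ref => [[|l X]] // /(allP satT).
Qed.
End Soundness.

Lemma filter_eq_count (A : eqType) (p q : pred A) (s : seq A) :
  subpred p q -> count q s <= count p s -> filter p s = filter q s.
Proof.
move=> pq; elim: s => //= a s IHs; have := sub_count pq s; have := pq a.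
by case: (p a) (q a) => [] [] //= *; rewrite ?IHs //; lia.
Qed.

(* The iterates form an increasing chain of sublists of [s]. *)
Lemma iter_filter_fixpoint (A : eqType) (s : seq A) (P : seq A -> pred A) :
    (forall t t', {subset t <= t'} -> subpred (P t) (P t')) ->
  let f t := filter (P t) s in f (iter (size s) f [::]) = iter (size s) f [::].
Proof.
move=> P_mono f; pose p i : pred A := if i is i'.+1 then P (iter i' f [::]) else pred0.
have tE i : iter i f [::] = filter (p i) s by case: i => //=; rewrite filter_pred0.
have p_mono i : subpred (p i) (p i.+1).
  elim: i => // i IHi; apply: P_mono => a; rewrite !tE !mem_filter => /andP[/IHi -> ->] //.
have stable i : count (p i.+1) s <= count (p i) s -> f (iter i f [::]) = iter i f [::].
  by move=> le_c; rewrite -iterS !tE (filter_eq_count (@p_mono i) le_c).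
(* Until it is stable, the chain gains an element per round; after [size s] rounds the list is full
   or stable. *)
have grow i : i <= count (p i) s \/ f (iter i f [::]) = iter i f [::].
  elim: i => [|i [IHi|IHi]]; first by left.
    case: (leqP (count (p i.+1) s) (count (p i) s)) => [/stable fx|lt_c].
      by right; rewrite iterS !fx.
    by left; apply: leq_trans lt_c.
  by right; rewrite iterS !IHi.
case: (grow (size s)) => // le_c; apply: stable.
by apply: leq_trans (count_size _ _) le_c.
Qed.

Lemma mem_lists_upto L n X :
  (X \in lists_upto L n) = (size X <= n) && all (fun x => x \in L) X.
Proof.
elim: n X => [|n IHn] X /=; first by rewrite inE; case: X.
rewrite mem_cat IHn.
apply/orP/andP => [[/andP[le_n ->]|/flatten_mapP[x xL /mapP[Y]]]|[]].
- by split=> //; apply: leqW.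
- by rewrite IHn => /andP[le_n sub_Y] -> /=; rewrite ltnS xL.
- case: X => [|x X] /= le_n => [_|/andP[xL sub_X]]; first by left.
  right; apply/flatten_mapP; exists x => //; apply: map_f.
  by rewrite IHn -ltnS le_n.
Qed.

(** * Completeness: simulating a refutation by unit propagation *)

Section Completeness.
Variables (k : nat) (G : seq (seq lit)).
Let T := derived k G.

Lemma falsified_mono (T1 T2 : seq (seq lit)) X Y y :
  {subset T1 <= T2} -> {subset X <= Y} -> falsified T1 X y -> falsified T2 Y y.
Proof.
move=> sT sX /orP[/sX yY|/hasP[t tT /allP t_sub]]; apply/orP; [by left | right].
apply/hasP; exists t; first exact: sT.
apply/allP => z /t_sub; rewrite !inE => /orP[->//|/sX ->]; exact: orbT.
Qed.

Lemma derived_fixpoint : derive k G T = T.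
Proof.
apply: (@iter_filter_fixpoint _ _ (rule G)) => T1 T2 sT X /hasP[D DGT /allP fD].
apply/hasP; exists D.
  by move: DGT; rewrite !mem_cat => /orP[->//|/sT ->]; rewrite orbT.
by apply/allP => y /fD; apply: falsified_mono.
Qed.

(** The fixed-point equation turns saturation into closure: every candidate justified by [T] is
    already in [T]. *)
Lemma mem_derived X :
  (X \in T) = [&& size X <= k.+1, all (fun x => x \in literals G) X & rule G T X].
Proof. by rewrite -{1}derived_fixpoint mem_filter mem_lists_upto andbC andbA. Qed.

Lemma literalsP D y : D \in G ++ T -> y \in D -> y \in literals G.
Proof.
rewrite mem_cat => /orP[DG yD|].
  by rewrite mem_cat; apply/orP/or_introl/flattenP; exists D.
by rewrite mem_derived => /and3P[_ /allP + _]; apply.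
Qed.

(* Unit propagation: [y] gets falsified when all of [A] is. *)
Inductive up (A : seq lit) : lit -> Prop :=
| up_mem y : y \in A -> up A y
| up_unit D y : D \in G ++ T -> neg y \in D ->
    (forall z, z \in D -> z != neg y -> up A z) -> up A y.

Definition conflict (A : seq lit) : Prop :=
  exists2 D, D \in G ++ T & forall z, z \in D -> up A z.

(** A cut: the derivation of [w] from [B] is substituted for the uses of [w] as a member of [A]. *)
Lemma up_cut A B w y :
  (forall z, z \in A -> z != w -> z \in B) -> up A y -> up B w -> up B y.
Proof.
move=> sAB uy uw; elim: y / uy => [y yA|D y DGT yD _ IH]; last exact: up_unit IH.
by case: (eqVneq y w) => [->//|neq]; apply/up_mem/sAB.
Qed.

Section Short.
Variable R : seq lit.
Hypotheses (R_le : size R <= k) (R_sub : all (fun x => x \in literals G) R).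

(** Each literal [y] propagated from the short [R] is recorded in [T] as [neg y :: R], a candidate
    because its length is at most [k + 1]. The clause [D] that propagates [y] justifies it, the
    other literals of [D] being falsified by induction. *)
Lemma up_falsified y : up R y -> falsified T R y.
Proof.
elim: y / => [y yR|D y DGT yD _ IH]; first by rewrite /falsified yR.
apply/orP; right; apply/hasP; exists (neg y :: R); last by apply/allP => z.
rewrite mem_derived /= ltnS R_le R_sub (literalsP DGT yD) /=.
apply/hasP; exists D => //; apply/allP => z zD.
case: (eqVneq z (neg y)) => [->|neq]; first by rewrite /falsified mem_head.
by apply: falsified_mono (IH z zD neq) => // x xR; rewrite inE xR orbT.
Qed.

Lemma conflict_derived : conflict R -> R \in T.
Proof.
case=> D DGT uD; rewrite mem_derived leqW // R_sub /=; apply/hasP; exists D => //.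
by apply/allP => z /uD; apply: up_falsified.
Qed.
End Short.

(** The short parent [A] lies in [T]. Once [R] is falsified, [x] is its only literal possibly left,
    so it propagates [neg x] as falsified; cutting [neg x] out of the conflict of [B] leaves a
    conflict of [R]. *)
Lemma conflict_resolvent A B R x :
    size A <= k -> all (fun x => x \in literals G) A -> conflict A -> conflict B ->
    x \in A -> (forall z, z \in A -> z != x -> z \in R) ->
    (forall z, z \in B -> z != neg x -> z \in R) ->
  conflict R.
Proof.
move=> le_A sub_A /(conflict_derived le_A sub_A) AT [D DGT uD] xA sAR sBR.
exists D => // z /uD uz; apply: up_cut sBR uz _.
apply: (@up_unit _ A); rewrite ?mem_cat ?AT ?orbT ?negK // => w wA neq.
exact/up_mem/sAR.
Qed.

(** [F] stands for a clause-set or its reduct by an assignment, and [G] for the original clauses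
    with the assignment as unit clauses: a literal removed from a clause has its negation as a unit
    clause in [G]. *)
Lemma wres_conflict (F : clause_set) (C : clause) :
    (forall C, C \in F -> {subset lits C <= literals G}) ->
    (forall C, C \in F -> exists2 D, D \in G &
       forall y, y \in D -> y \in lits C \/ [:: neg y] \in G) ->
  wres k F C -> conflict (lits C) /\ {subset lits C <= literals G}.
Proof.
move=> F_sub FG; elim: C / => [C CF|x C D R _ [cC sC] _ [cD sD] xC xD defR le_k].
  split; last exact: F_sub.
  have [D DG yD] := FG C CF; exists D; first by rewrite mem_cat DG.
  move=> z /yD[zC|zG]; first exact: up_mem.
  (* A removed literal [z] is falsified by the unit clause [[:: neg z]]. *)
  apply: (@up_unit _ [:: neg z]); rewrite ?mem_cat ?zG ?mem_head // => w.
  by rewrite inE => /eqP ->; rewrite eqxx.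
have memR z : z \in lits R = (z != x) && (z \in lits C) || (z != neg x) && (z \in lits D).
  by rewrite defR !inE.
split; last by move=> z; rewrite memR => /orP[] /andP[_]; [apply: sC | apply: sD].
case/orP: le_k => le_k.
  apply: (conflict_resolvent le_k _ cC cD xC); first exact/allP.
    by move=> z zC neq; rewrite memR zC neq.
  by move=> z zD neq; rewrite memR zD neq orbT.
apply: (conflict_resolvent le_k _ cD cC xD); first exact/allP.
  by move=> z zD neq; rewrite memR zD neq orbT.
by rewrite negK => z zC neq; rewrite memR zC neq.
Qed.

Lemma wres_refute (F : clause_set) :
    (forall C, C \in F -> {subset lits C <= literals G}) ->
    (forall C, C \in F -> exists2 D, D \in G &
       forall y, y \in D -> y \in lits C \/ [:: neg y] \in G) ->
  wres k F bot -> refute k G.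
Proof.
move=> F_sub FG /(wres_conflict F_sub FG)[cB _]; apply/hasP; exists [::] => //.
exact: (conflict_derived (R := [::])).
Qed.

End Completeness.


(** * Clause-sets and lists of lists *)

(** Agreement up to the order and multiplicity of literals and clauses. *)
Definition represents (s : seq (seq lit)) (F : clause_set) : Prop :=
  (forall C, C \in F -> exists2 D, D \in s & D =i lits C) /\
  (forall D, D \in s -> exists2 C, C \in F & D =i lits C).

Lemma list_code_lit (A : {pred lit}) d :
  list_code lit_code A d -> exists D : seq lit, [/\ d = enc D, uniq D & D =i A].
Proof.
case=> D [ds [uD DA FD ->]]; exists D; split=> //.
have -> // : ds = map enc D by elim: FD => //= x y s t -> _ ->.
Qed.

Lemma tree_size_lits (D : seq lit) : tree_size (enc D) <= 6 * size D + 1.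
Proof.
(* Six nodes per literal: the list cell, the pair, the atom and at most three for the sign. *)
elim: D => // -[v b] D IHD; rewrite tree_size_cons /= tree_size_pair.
by case: b; rewrite -[tree_size (enc v)]/1 -?[tree_size (enc true)]/3
  -?[tree_size (enc false)]/1; lia.
Qed.

Lemma clause_code_enc C d : clause_code C d ->
  exists D : seq lit, [/\ d = enc D, uniq D, D =i lits C & size D = size (lits C)].
Proof.
case/list_code_lit => D [-> uD DC]; exists D; split=> //.
exact/perm_size/(uniq_perm uD (fset_uniq _)).
Qed.

(** Each clause costs 6 per literal and 2 for its own list. There are at most [ell F + 1] clauses,
    since only the empty clause adds nothing to [ell F]; together this stays below
    [8 * (ell F).+1]. *)
Lemma clause_set_code_enc F d : clause_set_code F d ->
  exists s : seq (seq lit),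
    [/\ d = enc s, represents s F & tree_size (enc s) <= 8 * (ell F).+1].
Proof.
case=> cs [ds [ucs csF Fcs ->]].
have [s [ds_s s_size s_cs cs_s]] : exists s : seq (seq lit),
  [/\ ds = map enc s,
      tree_size (enc s) <= \sum_(C <- cs) (6 * size (lits C) + 2) + 1,
      forall C, C \in cs -> exists2 D, D \in s & D =i lits C &
      forall D, D \in s -> exists2 C, C \in cs & D =i lits C].
  elim: Fcs {ucs csF} => [|C d' cs' ds' /clause_code_enc[D [-> uD DC sD]] _].
    by exists [::]; rewrite big_nil; split.
  case=> s [-> le_s s_cs cs_s].
  exists (D :: s); split=> //.
  - rewrite tree_size_cons big_cons /= -sD -addSn -addnA; apply: leq_add le_s.
    by rewrite addn2 ltnS -addn1; apply: tree_size_lits.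
  - move=> C'; rewrite inE => /orP[/eqP -> | /s_cs[D' D's D'C]].
      by exists D; rewrite ?mem_head.
    by exists D' => //; rewrite inE D's orbT.
  - move=> D'; rewrite inE => /orP[/eqP -> | /cs_s[C' C'cs D'C]].
      by exists C; rewrite ?mem_head.
    by exists C' => //; rewrite inE C'cs orbT.
exists s; split; first by rewrite ds_s.
  split=> [C CF|D /cs_s[C Ccs DC]]; last by exists C; rewrite -?csF.
  by apply: s_cs; rewrite csF.
apply: leq_trans s_size _.
rewrite big_split -big_distrr big_const_seq iter_addn_0 count_predT /=.
have -> : ell F = \sum_(C <- cs) size (lits C).
  by apply/esym/perm_big/uniq_perm => //; apply: fset_uniq.
have: size cs <= \sum_(C <- cs) size (lits C) + count_mem bot cs.
  elim: (cs) => //= C cs' IH; rewrite big_cons.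
  rewrite -add1n addnACA leq_add //; case: (posnP (size (lits C))) => [sC0|sC].
    2: exact: ltn_addr.
  suff -> : C = bot by rewrite eqxx addn1.
  by apply/val_inj/eqP; rewrite -cardfs_eq0 /= sC0.
rewrite count_uniq_mem //; move: (\sum_(C <- cs) _) (size cs) => S n.
by case: (bot \in cs) => /=; lia.
Qed.

(** * Partial assignments and total valuations of all variables *)

Definition valuation (phi : passign) (v : nat) : bool := odflt false phi.[? v]%fmap.

Definition restr (V : {fset var}) (beta : nat -> bool) : passign :=
  passign_of [ffun v : V => beta (val v)].

Lemma fnd_restr V beta v :
  (restr V beta).[? v]%fmap = if v \in V then Some (beta v) else None.
Proof.
case: ifPn => vV; last by rewrite not_fnd.
by rewrite in_fnd ffunE.
Qed.

Lemma lit_true_restr V beta x :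
  lit_true (restr V beta) x = (x.1 \in V) && holds beta x.
Proof. by rewrite /lit_true fnd_restr; case: ifP. Qed.

Lemma lit_true_holds phi x : lit_true phi x -> holds (valuation phi) x.
Proof. by rewrite /lit_true /holds /valuation => /eqP ->. Qed.

Definition satF (beta : nat -> bool) (F : clause_set) : Prop :=
  forall C, C \in F -> has (holds beta) (lits C).

Lemma satFP s F beta : represents s F -> satF beta F <-> sat beta s.
Proof.
case=> Fs sF; split=> [satF|/allP sats C /Fs[D /sats hD DC]].
  by apply/allP => D /sF[C /satF hC DC]; rewrite (eq_has_r DC).
by rewrite -(eq_has_r DC).
Qed.

Lemma satisfiesP (phi : passign) (F : clause_set) :
  reflect (forall C, C \in F -> has (lit_true phi) (lits C)) (satisfies phi F).
Proof.
apply: (iffP eqP) => [F0 C CF|hF].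
  apply: contraT => nC; have : reduct phi C \in Defs.apply phi F.
    by apply/imfsetP; exists C; rewrite ?inE ?CF.
  by rewrite F0 inE.
apply/eqP; rewrite -[_ == _]negbK; apply/negP => /fset0Pn[D /imfsetP[C]].
by rewrite !inE /= => /andP[/hF ->].
Qed.

Lemma mem_vars F C x : C \in F -> x \in lits C -> x.1 \in vars F.
Proof.
by move=> CF xC; apply/bigfcupP; exists C; rewrite ?CF //; apply/imfsetP; exists x.
Qed.

Lemma satisfies_satF phi F : satisfies phi F -> satF (valuation phi) F.
Proof.
by move=> /satisfiesP hF C /hF /hasP[x xC hx]; apply/hasP; exists x => //; apply: lit_true_holds.
Qed.

Lemma satisfies_restr (V : {fset var}) beta F :
  (vars F `<=` V)%fset -> satisfies (restr V beta) F <-> satF beta F.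
Proof.
move=> /fsubsetP sV; split=> [/satisfiesP hF C /hF /hasP[x xC]|hF].
  by rewrite lit_true_restr => /andP[_ hx]; apply/hasP; exists x.
apply/satisfiesP => C CF; have /hasP[x xC hx] := hF C CF; apply/hasP; exists x => //.
by rewrite lit_true_restr hx (sV _ (mem_vars CF xC)).
Qed.

Lemma restr_valuation phi v : v \in domf phi -> phi.[? v]%fmap = Some (valuation phi v).
Proof. by move=> vphi; rewrite /valuation in_fnd. Qed.

Lemma satisfies_total phi F :
  total_on (vars F) phi -> satisfies phi F <-> satF (valuation phi) F.
Proof.
move=> /fsubsetP tot; split; first exact: satisfies_satF.
move=> hF; apply/satisfiesP => C CF; have /hasP[x xC hx] := hF C CF; apply/hasP; exists x => //.
by rewrite /lit_true (restr_valuation (tot _ (mem_vars CF xC))) (eqP hx).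
Qed.

Lemma satisfiableP F : satisfiable F <-> exists beta, satF beta F.
Proof.
split=> [[phi /satisfies_satF]|[beta hF]]; first by exists (valuation phi).
by exists (restr (vars F) beta); apply/satisfies_restr.
Qed.

(** As a clause has no complementary pair, this valuation makes all its literals false; it yields
    the counterexamples for VA and IM. *)
Definition falsifying (C : clause) (v : nat) : bool := (v, false) \in lits C.

Lemma neg_notin (C : clause) x : x \in lits C -> neg x \notin lits C.
Proof. by move/(allP (valP C)). Qed.

Lemma falsifyingP (C : clause) x : x \in lits C -> ~~ holds (falsifying C) x.
Proof.
move=> xC; have := neg_notin xC; move: xC; rewrite /holds /falsifying.
by case: x => v [] /= xC; [rewrite /neg /= => /negPf -> | rewrite xC].
Qed.

(** * The refutation procedure on [WC k] *)

Lemma wres_le j k F C : j <= k -> wres j F C -> wres k F C.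
Proof.
move=> le_jk; elim: C / => [C CF|x C D R _ hC _ hD xC xD defR le_j].
  exact: wres_axiom.
apply: (wres_step hC hD xC xD defR).
by case/orP: le_j => /leq_trans/(_ le_jk) ->; rewrite ?orbT.
Qed.

Lemma literals_lit (G : seq (seq lit)) D y : D \in G -> y \in D -> y \in literals G.
Proof. by move=> DG yD; rewrite mem_cat; apply/orP/or_introl/flattenP; exists D. Qed.

Section Refute.
Variables (k : nat) (F : clause_set) (s : seq (seq lit)) (phi : seq lit).
Hypotheses (sF : represents s F) (phi_cons : forall l, l \in phi -> neg l \notin phi).

Definition domain : {fset var} := [fset l.1 | l in phi]%fset.
Definition assignment (v : nat) : bool := (v, true) \in phi.

Lemma assignmentE l : l.1 \in domain -> (l \in phi) = holds assignment l.
Proof.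
case: l => v b /= /imfsetP[[v' b'] /= lphi def_v]; subst v'.
have := phi_cons lphi; rewrite /neg /holds /assignment /=.
by case: b lphi; case: b' => // lphi /negPf nphi; rewrite ?lphi ?nphi.
Qed.

Lemma lit_false_domain y : lit_false (restr domain assignment) y -> neg y \in phi.
Proof.
rewrite /lit_false fnd_restr; case: ifP => // ydom /eqP[].
by rewrite (@assignmentE (neg y)) // /holds /= => ->.
Qed.

(** A model of the reduct, overridden by [phi] on its domain, would satisfy both [s] and all of
    [phi]. *)
Lemma apply_unsat :
  (forall beta, sat beta s -> ~~ all (holds beta) phi) ->
  ~ satisfiable (Defs.apply (restr domain assignment) F).
Proof.
move=> unsat /satisfiableP[beta hF].
pose gamma v := if v \in domain then assignment v else beta v.
have /unsat /negP[] : sat gamma s.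
  apply/(satFP _ sF) => C CF; apply: contraT => nC.
  have ntrue : ~~ has (lit_true (restr domain assignment)) (lits C).
    apply: contra nC => /hasP[x xC]; rewrite lit_true_restr => /andP[xdom hx].
    by apply/hasP; exists x; rewrite // /holds /gamma xdom.
  have /hF /hasP[x] : reduct (restr domain assignment) C \in
                      Defs.apply (restr domain assignment) F.
    by apply/imfsetP; exists C; rewrite ?inE ?CF.
  rewrite !inE /= => /andP[xC nfalse] hx; case/negP: nC; apply/hasP; exists x => //.
  rewrite /holds /gamma; case: ifP => // xdom.
  move: nfalse; rewrite /lit_false fnd_restr xdom.
  by case: (assignment _); case: (x.2).
apply/allP => l lphi; have ldom : l.1 \in domain by apply/imfsetP; exists l.
by rewrite /holds /gamma ldom; rewrite assignmentE in lphi.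
Qed.

(** The cases follow the definition of [whd]. For unsatisfiable [F] only [F] itself is known to have
    a narrow refutation, which is simulated directly; for satisfiable [F] the maximum provides one
    for the reduct. An empty [F] has a satisfiable reduct. *)
Lemma refute_complete :
  WC k F -> (forall beta, sat beta s -> ~~ all (holds beta) phi) ->
  refute k (s ++ units phi).
Proof.
case=> h whdF le_hk unsat.
have direct : wres h F bot -> refute k (s ++ units phi).
  move/(wres_le le_hk); apply: wres_refute => C /(proj1 sF)[D Ds DC].
    by move=> y; rewrite -DC; apply: literals_lit; rewrite mem_cat Ds.
  by exists D => [|y]; rewrite ?mem_cat ?Ds // DC; left.
have Unsat := apply_unsat unsat.
case: whdF => [[F0 _]|[_ [wF _]]|[_ _ [_ /(_ _ Unsat)[j [wj _] le_jh]]]]; last 1 first.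
- move: wj => /(wres_le (leq_trans le_jh le_hk)); apply: wres_refute => C.
    case/imfsetP=> C' /=; rewrite !inE => /andP[/(proj1 sF)[D Ds DC] _] -> y.
    by rewrite !inE -DC => /andP[yD _]; apply: literals_lit yD; rewrite mem_cat Ds.
  case/imfsetP=> C' /=; rewrite !inE => /andP[/(proj1 sF)[D Ds DC] _] ->.
  exists D => [|y yD]; first by rewrite mem_cat Ds.
  rewrite !inE -DC yD /=; case: (boolP (lit_false _ y)) => [yF|]; last by left.
  by right; rewrite mem_cat; apply/orP/or_intror/map_f/lit_false_domain.
- by case: Unsat; apply/satisfiableP; exists xpredT => C; rewrite F0 => /imfsetP[C'];
    rewrite !inE.
- exact: direct.
Qed.

Lemma refuteP :
  WC k F -> refute k (s ++ units phi) <->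
            (forall beta, sat beta s -> ~~ all (holds beta) phi).
Proof.
move=> wF; split; last exact: refute_complete.
move=> /refute_sound unsat beta sat_s; apply: contra (unsat beta).
by rewrite -sat_units /sat all_cat => ->; rewrite andbT.
Qed.

End Refute.

(** * Correctness of the decision procedures *)

Lemma entails_satF F F' :
  entails F F' <-> (forall beta, satF beta F -> satF beta F').
Proof.
split=> [ent beta hF|ent phi].
  pose V := (vars F `|` vars F')%fset.
  apply/(satisfies_restr _ (fsubsetUr _ _ : (vars F' `<=` V)%fset)).
  apply: ent; first exact: fsubset_refl.
  by apply/satisfies_restr => //; apply: fsubsetUl.
rewrite /total_on fsubUset => /andP[/satisfies_total E /satisfies_total E'] /E hF.
by apply/E'/ent.
Qed.

Lemma entails_algP k F s C D :
  WC k F -> represents s F -> D =i lits C ->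
  entails_alg k (s, D) <-> (forall beta, satF beta F -> has (holds beta) (lits C)).
Proof.
move=> wF sF DC; rewrite /entails_alg /= (@refuteP k F) //; last first.
  (* The negated literals form a consistent assignment because [C] has no complementary pair. *)
  move=> _ /mapP[l lD ->]; rewrite (mem_map (can_inj negK)) DC.
  by apply: neg_notin; rewrite -DC.
have allE beta : ~~ all (holds beta) (map neg D) = has (holds beta) (lits C).
  rewrite -(eq_has_r DC) all_map -[has _ _]negbK -all_predC.
  by congr (~~ _); apply: eq_all => l /=; rewrite holds_neg.
split=> [hs beta /(satFP _ sF) /hs|hs beta /(satFP _ sF) /hs]; by rewrite allE.
Qed.

Lemma entails_all_algP k F F' s s' :
  WC k F -> represents s F -> represents s' F' ->
  entails_all_alg k (s, s') <-> entails F F'.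
Proof.
move=> wF sF sF'; rewrite entails_satF; split.
  move=> /allP ent beta hF C /(proj1 sF')[D /ent + DC].
  by move/(entails_algP wF sF DC); apply.
move=> ent; apply/allP => D /(proj2 sF')[C CF' DC].
by apply/(entails_algP wF sF DC) => beta /ent; apply.
Qed.

Lemma CO_P k F s : WC k F -> represents s F -> ~~ refute k s <-> CO F.
Proof.
move=> wF sF; have := refuteP sF (phi := [::]) (fun l _ => isT : neg l \notin [::]) wF.
rewrite cats0 /CO satisfiableP; case: refute => -[h1 h2]; split=> //.
  by case=> beta /(satFP _ sF) /h1 => /(_ isT).
move=> _; apply: Classical_Prop.NNPP => nsat; suff: false by [].
apply: h2 => beta sat_s; case: nsat; exists beta; exact/(satFP _ sF).
Qed.

Lemma nilp_represents s F : represents s F -> nilp s <-> F = fset0.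
Proof.
case=> Fs sF; split=> [/nilP s0|F0].
  by apply/eqP; rewrite -[_ == _]negbK; apply/negP => /fset0Pn[C /Fs[D]]; rewrite s0.
by case: s sF {Fs} => // D s /(_ D (mem_head _ _))[C]; rewrite F0.
Qed.

(** Any clause is falsified by some valuation, so only the empty clause-set is always satisfied. *)
Lemma VA_P F s : represents s F -> nilp s <-> VA F.
Proof.
move=> sF; rewrite (nilp_represents sF); split=> [-> phi _|va].
  by apply/satisfiesP.
apply/eqP; rewrite -[_ == _]negbK; apply/negP => /fset0Pn[C CF].
have /satisfies_restr : satisfies (restr (vars F) (falsifying C)) F.
  by apply: va; apply: fsubset_refl.
by move=> /(_ (fsubset_refl _) C CF) /hasP[x /falsifyingP/negP].
Qed.

Lemma IM_P F s phi t :
  represents s F -> t =i lit_true phi -> implicant_alg (s, t) <-> IM (F, phi).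
Proof.
move=> sF tphi; rewrite /implicant_alg /=; split=> [/allP imp psi ext _|imp].
  apply/satisfiesP => C /(proj1 sF)[D /imp + DC]; rewrite (eq_has_r DC).
  case/hasP=> x xC; rewrite tphi => /eqP/ext hx; apply/hasP; exists x => //.
  exact/eqP.
apply/allP => D /(proj2 sF)[C CF DC]; rewrite (eq_has_r DC); apply: contraT => nC.
(* If [phi] makes no literal of [C] true, extending it by values falsifying the rest of [C] refutes
   the implication. *)
pose beta v := if phi.[? v]%fmap is Some b then b else falsifying C v.
pose psi := restr (domf phi `|` vars F)%fset beta.
have /satisfiesP/(_ C CF)/hasP[x xC] : satisfies psi F.
  apply: (imp psi) => [v b /= vb|]; last exact: fsubsetUr.
  rewrite fnd_restr inE; case: fndP vb => // kf [<-] /=.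
  by rewrite /beta in_fnd.
rewrite lit_true_restr /holds /beta => /andP[_].
case def_x: (phi.[? x.1]%fmap) => [b|]; last first.
  by have := falsifyingP xC; rewrite /holds => /negPf ->.
by move=> /eqP def_b; case/hasP: nC; exists x; rewrite // tphi; apply/eqP; rewrite def_x def_b.
Qed.


(** * From power bounds to polynomials *)

Lemma poly_linear_exp (a b c : nat) :
  exists p : {poly nat}, forall n, p.[n]%R = (a * n + b) ^ c.
Proof.
exists ((a%:P * 'X + b%:P) ^+ c)%R => n.
by rewrite horner_exp !hornerE natrXE.
Qed.

Lemma poly_bilinear_exp (a c : nat) :
  exists p : {poly {poly nat}},
    forall m n, p.[(m%:P)%R].[n]%R = (a * (n.+1 * m.+1)) ^ c.
Proof.
(* The outer indeterminate stands for [m], the inner one for [n]. *)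
exists (((a%:P * ('X + 1))%:P * ('X + 1)) ^+ c)%R => m n.
by rewrite -(addn1 n) -(addn1 m) !hornerE natrXE.
Qed.

Lemma ptime_decidableP (I A : Type) `{Enc A} (code : I -> tree -> Prop)
    (size : I -> nat) (dom Q : I -> Prop) (f : A -> bool) :
    ptime f ->
    (forall x, dom x -> forall d, code x d ->
       exists a, [/\ d = enc a, tree_size (enc a) <= 32 * (size x).+1 & f a <-> Q x]) ->
  ptime_decidable code size dom Q.
Proof.
case=> [P [T [PT [c T_le] _]]] decode.
(* 34 is 32 plus the 2 in the base of [dominated]; the factor 32 is generous enough for all
   queries. *)
have [p pE] := poly_linear_exp 32 34 c.
exists P, p => x /decode{}decode d /decode[a [-> a_le fQ]].
have [t run_t t_le] := PT a; exists (f a), t; split=> //.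
rewrite pE; apply: leq_trans t_le _; apply: leq_trans (T_le a) _.
by case: (c) => // c'; rewrite leq_exp2r //; lia.
Qed.

(** * Correctness and output size of the enumeration *)

Section Enumeration.
Variables (k : nat) (F : clause_set) (s : seq (seq lit)).
Hypotheses (wF : WC k F) (sF : represents s F).

Definition graph_on (vs : seq nat) (beta : nat -> bool) : seq lit :=
  [seq (v, beta v) | v <- vs].

Lemma mem_graph_on vs beta l : (l \in graph_on vs beta) = (l.1 \in vs) && holds beta l.
Proof.
case: l => v b; apply/mapP/andP => /= [[u uvs [-> ->]]|[vvs /eqP /= def_b]].
  by rewrite /holds eqxx.
by exists v; rewrite // def_b.
Qed.

Lemma graph_onP vs phi beta :
  map fst phi = vs -> all (holds beta) phi -> phi = graph_on vs beta.
Proof.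
move=> <-; elim: phi => //= -[v b] phi IH /andP[/eqP /= <- /IH def_phi].
by rewrite [in LHS]def_phi.
Qed.

Lemma uniq_fst_neg (phi : seq lit) :
  uniq (map fst phi) -> forall l, l \in phi -> neg l \notin phi.
Proof.
have neq_neg l : (neg l == l) = false by case: l => v []; apply/eqP => -[].
elim: phi => //= x phi IH /andP[x_phi /IH{}IH] l; rewrite !inE => /orP[/eqP ->|lphi].
  rewrite neq_neg /=; apply: contra x_phi => nx_phi.
  by apply/mapP; exists (neg x).
rewrite negb_or IH // andbT; apply: contra x_phi => /eqP <-.
by apply/mapP; exists l.
Qed.

Lemma consistent_withP vs phi : uniq vs -> map fst phi = vs ->
  ~~ refute k (s ++ units phi) <->
  (exists2 beta, sat beta s & phi = graph_on vs beta).
Proof.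
move=> uvs def_vs; split=> [nref|[beta sat_s def_phi]]; last first.
  apply/negP => /(refute_sound beta); rewrite /sat all_cat -!/(sat _ _) sat_s sat_units.
  by case/negP; apply/allP => l; rewrite def_phi mem_graph_on => /andP[].
have phi_cons : forall l, l \in phi -> neg l \notin phi.
  by apply: uniq_fst_neg; rewrite def_vs.
apply: Classical_Prop.NNPP => nex; case/negP: nref.
apply: (refute_complete sF phi_cons wF) => beta sat_s; apply/negP => hphi; case: nex.
by exists beta => //; apply: graph_onP.
Qed.

(** The refutation test keeps exactly the assignments extending to a model. Their variables come in
    the order of [vs], so each restriction of a model has a single list. *)
Lemma mem_enumerate_over vs phi : uniq vs ->
  phi \in enumerate_over k s vs <->
  (exists2 beta, sat beta s & phi = graph_on vs beta).
Proof.
elim: vs phi => [|v vs IH] phi.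
  move=> uvs; rewrite mem_filter inE; split=> [/andP[nref /eqP def_phi]|ex].
    by apply/(consistent_withP uvs) => //; rewrite def_phi.
  have [beta _ def_phi] := ex; apply/andP; split; last by rewrite def_phi.
  by apply/(consistent_withP uvs) => //; rewrite def_phi.
move=> uvvs; have uvs : uniq vs by case/andP: uvvs.
rewrite mem_filter; split=> [/andP[nref]|].
  rewrite mem_cat => phi_br; apply/(consistent_withP uvvs) => //.
  have [b [psi psi_in ->]] : exists b, exists2 psi,
      psi \in enumerate_over k s vs & phi = (v, b) :: psi.
    by case/orP: phi_br => /mapP[psi psi_in ->]; [exists true | exists false]; exists psi.
  (* Only the variables of [psi] are taken from the induction hypothesis; the model comes from the
     test on [phi]. *)
  have [beta _ ->] := (IH psi uvs).1 psi_in.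
  by rewrite /= /graph_on -map_comp map_id_in.
move=> ex; have [beta sat_s def_phi] := ex; apply/andP; split.
  apply/(consistent_withP uvvs) => //.
  by rewrite def_phi /graph_on -map_comp map_id_in.
have psi_in : graph_on vs beta \in enumerate_over k s vs by apply/(IH _ uvs); exists beta.
rewrite def_phi mem_cat /graph_on /=; case: (beta v).
  by apply/orP; left; apply: map_f.
by apply/orP; right; apply: map_f.
Qed.

Lemma enumerate_over_uniq vs : uniq (enumerate_over k s vs).
Proof.
elim: vs => [|v vs IH]; first exact: (@filter_uniq _ [:: [::]]).
apply: (@filter_uniq _ (branch v (enumerate_over k s vs))).
have inj b : injective (cons ((v, b) : lit)) by move=> x y [].
rewrite cat_uniq !map_inj_uniq // IH andbT /=; apply/hasPn => x /mapP[y _ ->].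
by apply/negP => /mapP[z _ []].
Qed.

Lemma mem_variables v : v \in variables s = (v \in vars F).
Proof.
rewrite mem_undup; apply/mapP/bigfcupP => [[x /flattenP[D /(proj2 sF)[C CF DC] xD] ->]|].
  by exists C; rewrite ?CF //; apply/imfsetP; exists x; rewrite // -DC.
case=> C; rewrite andbT => /(proj1 sF)[D Ds DC] /imfsetP[x /= xC ->].
by exists x => //; apply/flattenP; exists D; rewrite ?DC.
Qed.

Definition models_of (phis : seq (seq lit)) : seq passign :=
  [seq restr (vars F) (assignment phi) | phi <- phis].

Lemma restr_graph_on beta :
  restr (vars F) (assignment (graph_on (variables s) beta)) = restr (vars F) beta.
Proof.
congr passign_of; apply/ffunP => v; rewrite !ffunE /assignment mem_graph_on /=.
by rewrite mem_variables (valP v) /holds /= eqb_id.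
Qed.

Lemma restr_inj beta gamma : restr (vars F) beta = restr (vars F) gamma ->
  graph_on (variables s) beta = graph_on (variables s) gamma.
Proof.
move=> eq_r; apply/eq_in_map => v; rewrite mem_variables => vF; congr (_, _).
by have := congr1 (fun phi : passign => phi.[? v]%fmap) eq_r; rewrite /= !fnd_restr vF => -[].
Qed.

Lemma mem_modelsP phi :
  phi \in models F <-> (exists2 beta, sat beta s & phi = restr (vars F) beta).
Proof.
split=> [/imfsetP[f /=]|[beta /(satFP _ sF) hF ->]]; last first.
  apply/imfsetP; exists [ffun v : vars F => beta (val v)] => //=; rewrite inE /=.
  exact/satisfies_restr.
rewrite inE /= => /satisfies_satF hF ->; exists (valuation (passign_of f)).
  exact/(satFP _ sF).
congr passign_of; apply/ffunP => v; rewrite ffunE /valuation in_fnd ?(valP v) //= => vF.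
by congr (f _); apply: val_inj.
Qed.

Lemma mem_enumerate phi :
  phi \in enumerate k s <->
  (exists2 beta, sat beta s & phi = graph_on (variables s) beta).
Proof. exact/mem_enumerate_over/undup_uniq. Qed.

Lemma models_of_uniq : uniq (models_of (enumerate k s)).
Proof.
rewrite map_inj_in_uniq; first exact: enumerate_over_uniq.
move=> phi psi /mem_enumerate[beta _ ->] /mem_enumerate[gamma _ ->].
by rewrite !restr_graph_on => /restr_inj.
Qed.

Lemma mem_models_of : models_of (enumerate k s) =i models F.
Proof.
move=> phi; apply/mapP/idP => [[psi /mem_enumerate[beta sat_s ->] ->]|].
  by apply/mem_modelsP; exists beta => //; apply: restr_graph_on.
case/mem_modelsP => beta sat_s ->; exists (graph_on (variables s) beta).
  by apply/mem_enumerate; exists beta.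
by rewrite restr_graph_on.
Qed.

Lemma size_enumerate : size (enumerate k s) = #|` models F|%fset.
Proof.
rewrite -(size_map (fun phi => restr (vars F) (assignment phi))).
exact/perm_size/(uniq_perm models_of_uniq (fset_uniq _))/mem_models_of.
Qed.

(** Every surviving partial assignment extends to a model, so dropping the entries for [us] maps the
    final list onto the intermediate one. Hence no stage exceeds the number of models. *)
Lemma size_enumerate_over us vs : variables s = us ++ vs ->
  size (enumerate_over k s vs) <= #|` models F|%fset.
Proof.
move=> def_vs; have := undup_uniq (map fst (flatten s)).
rewrite -/(variables s) def_vs cat_uniq => /and3P[_ _ uvs].
rewrite -size_enumerate -[leqRHS](size_map (drop (size us))).
apply: uniq_leq_size (enumerate_over_uniq _) _ => phi /(mem_enumerate_over _ uvs).
case=> beta sat_s ->; apply/mapP; exists (graph_on (variables s) beta).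
  by apply/mem_enumerate; exists beta.
by rewrite /graph_on def_vs map_cat drop_size_cat ?size_map.
Qed.

Lemma tree_size_enumerate_over us vs : variables s = us ++ vs ->
  tree_size (enc (enumerate_over k s vs)) <=
  #|` models F|%fset * (6 * tree_size (enc s) + 2) + 1.
Proof.
move=> def_vs; have le_vs : size vs <= tree_size (enc s).
  apply: leq_trans (_ : size (variables s) <= _); first by rewrite def_vs size_cat leq_addl.
  apply: leq_trans (size_undup _) _; rewrite size_map; apply: leq_trans (tree_size_flatten s).
  exact/ltnW/size_le_tree_size.
have := size_enumerate_over def_vs; move: (#|` _|) => m le_m.
apply: leq_trans (_ : size (enumerate_over k s vs) * (6 * tree_size (enc s) + 2) + 1 <= _);
  last by rewrite leq_add2r leq_mul2r le_m orbT.
have uvs : uniq vs.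
  have := undup_uniq (map fst (flatten s)).
  by rewrite -/(variables s) def_vs cat_uniq => /and3P[].
have {le_m} : forall phi, phi \in enumerate_over k s vs ->
    tree_size (enc phi) <= 6 * tree_size (enc s) + 1.
  move=> phi /(mem_enumerate_over _ uvs)[beta _ ->].
  apply: leq_trans (tree_size_lits _) _.
  by rewrite leq_add2r leq_mul2l /= size_map.
elim: (enumerate_over _ _ _) => [//|phi phis IH] le_n.
rewrite tree_size_cons -[size _]/(size phis).+1 [_.+1 * _]mulSn -addnA -addSn leq_add //.
  by rewrite addn2 ltnS -addn1 le_n ?mem_head.
by apply: IH => psi psi_in; apply: le_n; rewrite inE psi_in orbT.
Qed.

Lemma models_code_enumerate : models_code F (enc (enumerate k s)).
Proof.
exists (models_of (enumerate k s)), (map enc (enumerate k s)); split=> //.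
- exact: models_of_uniq.
- exact: mem_models_of.
have : {subset enumerate k s <= enumerate k s} by [].
elim: {1 3 4}(enumerate k s) => [|phi phis IH] sub /=; first by constructor.
constructor; last by apply: IH => psi psi_in; apply: sub; rewrite inE psi_in orbT.
have /mem_enumerate[beta _ ->] := sub phi (mem_head _ _).
exists (graph_on (variables s) beta), (map enc (graph_on (variables s) beta)); split=> //.
- by rewrite map_inj_uniq ?undup_uniq // => u v [].
- by move=> l; rewrite restr_graph_on mem_graph_on mem_variables -lit_true_restr.
- by elim: (graph_on _ _) => [|l t IHt] /=; constructor.
Qed.

End Enumeration.

Lemma ptime_enumerable_models_WC k : ptime_enumerable_models (WC k).
Proof.
(* The program is analysed on all lists [G], so [m] is a maximum over the stages; the number of
   models bounds it only for [G] representing a member of [WC k]. *)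
pose (m := fun G : seq (seq lit) => \max_(i < (size (variables G)).+1)
  tree_size (enc (enumerate_over k G (drop i (variables G))))).
have m_le G us vs : variables G = us ++ vs -> tree_size (enc (enumerate_over k G vs)) <= m G.
  move=> def_vs; have lt_us : size us < (size (variables G)).+1.
    by rewrite def_vs size_cat ltnS leq_addr.
  apply: leq_trans (leq_bigmax (Ordinal lt_us)) => /=.
  by rewrite def_vs drop_size_cat.
have [P [T [PT [c T_le] _]]] := computable_enumerate m_le.
(* 64 exceeds the factors 8 from the input size and 48 = 6 * 8 from the stages, with the additive
   constants. *)
have [p pE] := poly_bilinear_exp 64 c.
exists P, p => F wF d /clause_set_code_enc[s [-> sF s_le]].
have [t run_t t_le] := PT s; exists (enc (enumerate k s)), t; split=> //.
  exact: models_code_enumerate.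
rewrite pE; apply: leq_trans t_le _; apply: leq_trans (T_le s) _.
have : m s <= #|` models F|%fset * (6 * tree_size (enc s) + 2) + 1.
  apply/bigmax_leqP => i _; apply: (tree_size_enumerate_over wF sF (us := take i (variables s))).
  by rewrite cat_take_drop.
move: (#|` _|) => n m_bound; case: (c) => // c'; rewrite leq_exp2r //.
by move: s_le m_bound; move: (tree_size _) (m s) (ell F) => a b l; nia.
Qed.

(** * Assembly of the seven queries *)

Theorem theorem7p1 (k : nat) :
  ptime_decidable clause_set_code ell (WC k) CO
  /\ ptime_decidable (pair_code clause_set_code clause_code)
       (fun FC : clause_set * clause => ell FC.1 + #|` lits FC.2|%fset)
       (fun FC => WC k FC.1) CE
  /\ ptime_decidable clause_set_code ell (WC k) VA
  /\ ptime_decidable (pair_code clause_set_code passign_code)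
       (fun Fphi : clause_set * passign => ell Fphi.1 + #|` domf Fphi.2|%fset)
       (fun Fphi => WC k Fphi.1) IM
  /\ ptime_decidable (pair_code clause_set_code clause_set_code)
       (fun FF : clause_set * clause_set => ell FF.1 + ell FF.2)
       (fun FF => WC k FF.1 /\ WC k FF.2) EQ
  /\ ptime_decidable (pair_code clause_set_code clause_set_code)
       (fun FF : clause_set * clause_set => ell FF.1 + ell FF.2)
       (fun FF => WC k FF.1 /\ WC k FF.2) SE
  /\ ptime_enumerable_models (WC k).
Proof.
split; [|split; [|split; [|split; [|split; [|split]]]]].
- apply: (ptime_decidableP (ptime_negb (ptime_refute k))) => F wF d.
  case/clause_set_code_enc => s [-> sF s_le]; exists s; split=> //; first by lia.
  exact: CO_P.
- apply: (ptime_decidableP (ptime_entails_alg k)) => -[F C] /= wF d.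
  case=> a [b [/clause_set_code_enc[s [-> sF s_le]] + ->]].
  case/clause_code_enc => D [-> uD DC sD]; exists (s, D); split=> //.
    rewrite tree_size_pair -sD; move: (tree_size_lits D) s_le.
    by move: (tree_size _) (tree_size _) (size D) (ell F) => *; lia.
  rewrite (entails_algP wF sF DC) /CE entails_satF.
  split=> ent beta /ent; last by apply; rewrite inE.
  by move=> hC C'; rewrite inE => /eqP ->.
- apply: (ptime_decidableP (@ptime_nilp (seq lit) _ _ _ _ ptime_id)) => F wF d.
  case/clause_set_code_enc => s [-> sF s_le]; exists s; split=> //; first by lia.
  exact: VA_P.
- apply: (ptime_decidableP ptime_implicant_alg) => -[F phi] /= wF d.
  case=> a [b [/clause_set_code_enc[s [-> sF s_le]] + ->]].
  case/list_code_lit => t [-> ut tphi]; exists (s, t); split=> //; last exact: IM_P.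
  (* An assignment makes at most one literal true per variable. *)
  have t_le : size t <= #|` domf phi|%fset.
    rewrite -(size_map fst); apply: uniq_leq_size.
      rewrite map_inj_in_uniq // => -[u b1] [v b2]; rewrite !tphi => /eqP /= h1 /eqP /= h2 uv.
      by move: h1; rewrite /= uv h2 => -[->].
    move=> v /mapP[l]; rewrite tphi => /eqP hl ->; apply: contraT => /not_fnd.
    by rewrite hl.
  rewrite tree_size_pair; move: (tree_size_lits t) s_le t_le.
  by move: (tree_size _) (tree_size _) (size t) (ell F) (#|` _|) => *; lia.
(* Equivalence is tested as two entailments, each from a member of [WC k]. *)
- pose f (x : seq (seq lit) * seq (seq lit)) :=
    entails_all_alg k x && entails_all_alg k (x.2, x.1).
  have fP : ptime f.
    apply: ptime_andb; first exact: ptime_entails_all_alg.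
    refine (ptime_comp _ (ptime_entails_all_alg k)).
    by apply: ptime_pair; [apply/ptime_snd/ptime_id | apply/ptime_fst/ptime_id].
  apply: (ptime_decidableP fP) => -[F F'] /= [wF wF'] d.
  case=> a [b [/clause_set_code_enc[s [-> sF s_le]] + ->]].
  case/clause_set_code_enc => s' [-> sF' s'_le]; exists (s, s'); split=> //.
    rewrite tree_size_pair; move: s_le s'_le => /=.
    by move: (tree_size _) (tree_size _) => *; lia.
  rewrite /f /EQ /=; split=> [/andP[]|eqF].
    move=> /(entails_all_algP wF sF sF') e1 /(entails_all_algP wF' sF' sF) e2 phi tot.
    by apply/idP/idP; [apply: e1 | apply: e2; rewrite fsetUC].
  apply/andP; split.
    by apply/(entails_all_algP wF sF sF') => phi /eqF ->.
  by apply/(entails_all_algP wF' sF' sF) => phi; rewrite fsetUC => /eqF ->.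
- apply: (ptime_decidableP (ptime_entails_all_alg k)) => -[F F'] /= [wF wF'] d.
  case=> a [b [/clause_set_code_enc[s [-> sF s_le]] + ->]].
  case/clause_set_code_enc => s' [-> sF' s'_le]; exists (s, s'); split=> //.
    rewrite tree_size_pair; move: s_le s'_le => /=.
    by move: (tree_size _) (tree_size _) => *; lia.
  exact: entails_all_algP.
- exact: ptime_enumerable_models_WC.
Qed.
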